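(* For every even integer $2n+2>2$ there exists an integrable LCK manifold of real dimension $2n+2$ which is not globally conformal Kähler.
   Context: All manifolds are smooth of real dimension $2n+2$ with $n\ge 1$. A Hermitian manifold $(M,J,g)$ consists of a $(1,1)$-tensor field $J$ with $J^2=-\mathrm{Id}$ and vanishing Nijenhuis torsion, and a Riemannian metric $g$ with $g(JX,JY)=g(X,Y)$. Its fundamental $2$-form is $\Omega(X,Y)=g(X,JY)$. The codifferential is $\delta=-\sum_k i_{E_k}\nabla_{E_k}$ for a local orthonormal frame $(E_k)$ and the Levi-Civita connection $\nabla$. The anti-Lee $1$-form is $\eta=\frac1n\delta\Omega$ and the Lee $1$-form is $\theta(X)=\eta(JX)$; equivalently $\eta(X)=-\theta(JX)$. The manifold is locally conformal Kähler (LCK) if $d\Omega=\theta\wedge\Omega$ and $d\theta=0$, where $(\theta\wedge\Omega)(X,Y,Z)=\theta(X)\Omega(Y,Z)+\theta(Y)\Omega(Z,X)+\theta(Z)\Omega(X,Y)$. It is globally conformal Kähler if $\theta$ is exact (equivalently, $g$ is globally conformal to a metric which is Kähler with respect to $J$). The anti-Lee vector field $V$ is the metric dual of $\eta$. An LCK manifold is integrable if $V$ is nowhere zero and the distribution $V^\perp=\ker\eta$ is integrable. *)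

(* Defs.v *)
From HB Require Import structures.
From mathcomp Require Import all_boot all_order all_algebra.
From mathcomp Require Import all_classical all_reals all_analysis.
From mathcomp Require Import ring.

Set Implicit Arguments.
Unset Strict Implicit.
Unset Printing Implicit Defensive.

Import Order.TTheory GRing.Theory Num.Theory.
Import numFieldNormedType.Exports.

Local Open Scope classical_set_scope.
Local Open Scope ring_scope.

(* Conventions.  Tangent vectors are row vectors, so a linear map acts on the
   right: the differential of [f] at [x] is [v |-> v *m 'J f x], a field of
   endomorphisms [A] has [A (\partial_a) = \sum_b A a b \partial_b], a bilinear
   form [B] has [B (u, v) = u *m B *m v^T], and a 1-form is a column vector.
   Tensor fields are given by their components in the charts of an atlas. *)

Section Smooth.
Context {R : realType} {k : nat} {W : normedModType R}.
Implicit Types (U : set 'rV[R]_k) (f : 'rV[R]_k -> W).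

Definition pd (a : 'I_k) f : 'rV[R]_k -> W := 'D_(delta_mx 0 a) f.

(* For open [U]: the partial derivatives of order at most [N] exist and are
   continuous on [U]. *)
Fixpoint Cn (N : nat) U f : Prop :=
  (forall x, U x -> {for x, continuous f}) /\
  (if N is N'.+1 then
     forall a : 'I_k,
       (forall x, U x -> derivable f x (delta_mx 0 a)) /\ Cn N' U (pd a f)
   else True).

Definition smooth U f : Prop := forall N, Cn N U f.

End Smooth.

Section Manifolds.
Context {R : realType} {m : nat}.

Record chart (T : topologicalType) := Chart {
  dom : set T ;
  crd :> T -> 'rV[R]_m ;
  param : 'rV[R]_m -> T ;  (* inverse of [crd]; arbitrary off [crd @` dom] *)
  dom_open : open dom ;
  crd_dom_open : open (crd @` dom) ;
  crdK : forall p, dom p -> param (crd p) = p ;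
  crd_continuous : forall p, dom p -> {for p, continuous crd} ;
  param_continuous :
    forall x, (crd @` dom) x -> {for x, continuous param}
}.

Definition cod (T : topologicalType) (c : chart T) : set 'rV[R]_m :=
  c @` dom c.

Definition overlap (T : topologicalType) (c c' : chart T) : set 'rV[R]_m :=
  c @` (dom c `&` dom c').

Definition transition (T : topologicalType) (c c' : chart T) :
  'rV[R]_m -> 'rV[R]_m := c' \o param c.

End Manifolds.
Arguments chart R m T : clear implicits.

Record smooth_manifold (R : realType) (m : nat) := SmoothManifold {
  points :> topologicalType ;
  points_hausdorff : hausdorff_space points ;
  points_second_countable : @second_countable points ;
  atlas : set (chart R m points) ;
  atlas_cover : forall p : points, exists2 c, atlas c & dom c p ;
  atlas_compatible : forall c c', atlas c -> atlas c' ->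
    smooth (overlap c c') (transition c c')
}.
Arguments atlas {R m} s.

Section TensorFields.
Context {R : realType} {m : nat} (M : smooth_manifold R m).

Record endomorphism_field := EndomorphismField {
  endo :> chart R m M -> 'rV[R]_m -> 'M[R]_m ;
  endo_smooth : forall c, atlas M c -> smooth (cod c) (endo c) ;
  endo_transition : forall c c', atlas M c -> atlas M c' ->
    forall x, overlap c c' x ->
      endo c x *m 'J (transition c c') x =
      'J (transition c c') x *m endo c' (transition c c' x)
}.

Record riemannian_metric := RiemannianMetric {
  metric :> chart R m M -> 'rV[R]_m -> 'M[R]_m ;
  metric_smooth : forall c, atlas M c -> smooth (cod c) (metric c) ;
  metric_transition : forall c c', atlas M c -> atlas M c' ->
    forall x, overlap c c' x ->
      metric c x = 'J (transition c c') x *m metric c' (transition c c' x)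
                     *m ('J (transition c c') x)^T ;
  metric_sym : forall c, atlas M c -> forall x, cod c x ->
    (metric c x)^T = metric c x ;
  metric_pos : forall c, atlas M c -> forall x, cod c x ->
    forall v : 'rV[R]_m, v != 0 -> 0 < (v *m metric c x *m v^T) 0 0
}.

End TensorFields.

Section LocalCalculus.
Context {R : realType} {m : nat}.
Implicit Types (g J Om : 'rV[R]_m -> 'M[R]_m) (X Y : 'rV[R]_m -> 'rV[R]_m).
Implicit Types (th : 'rV[R]_m -> 'cV[R]_m) (x : 'rV[R]_m).

Definition lie_bracket X Y x : 'rV[R]_m := 'D_(X x) Y x - 'D_(Y x) X x.

Definition app_endo J X : 'rV[R]_m -> 'rV[R]_m := fun x => X x *m J x.

Definition nijenhuis J X Y x : 'rV[R]_m :=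
  lie_bracket (app_endo J X) (app_endo J Y) x
  - app_endo J (lie_bracket (app_endo J X) Y) x
  - app_endo J (lie_bracket X (app_endo J Y)) x
  - lie_bracket X Y x.

(* [christoffel g x a b d] is the coefficient of [\partial_d] in
   [\nabla_{\partial_a} \partial_b], for the Levi-Civita connection of [g]. *)
Definition christoffel g x (a b d : 'I_m) : R :=
  2^-1 * \sum_(e < m) invmx (g x) d e *
    (pd a (fun y => g y b e) x + pd b (fun y => g y a e) x
     - pd e (fun y => g y a b) x).

(* [(\nabla_{\partial_a} Om) (\partial_b, \partial_c)] *)
Definition nabla2 g Om x (a b c : 'I_m) : R :=
  pd a (fun y => Om y b c) x
  - \sum_(d < m) christoffel g x a b d * Om x d c
  - \sum_(d < m) christoffel g x a c d * Om x b d.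

(* The rows of [E] form a basis that is orthonormal for [g x]. *)
Definition orthonormal_basis g x (E : 'M[R]_m) : Prop :=
  E *m g x *m E^T = 1%:M.

(* [- \sum_k (\nabla_{E_k} Om) (E_k, \partial_c)] *)
Definition codiff_in (E : 'M[R]_m) g Om x : 'cV[R]_m :=
  \col_c - \sum_(k < m) \sum_(a < m) \sum_(b < m)
     E k a * E k b * nabla2 g Om x a b c.

(* The value at [x] depends on the frame through its value at [x] only.  An
   orthonormal basis exists ([orthonormal_basis_exists]) and its choice is
   irrelevant ([codiffE]). *)
Definition codiff g Om x : 'cV[R]_m :=
  codiff_in (xget 0 [set E | orthonormal_basis g x E]) g Om x.

(* [Omega (X, Y) = g (X, J Y)] *)
Definition fundamental_form g J x : 'M[R]_m := g x *m (J x)^T.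

Definition d1 th x (a b : 'I_m) : R :=
  pd a (fun y => th y b 0) x - pd b (fun y => th y a 0) x.

Definition d2 Om x (a b c : 'I_m) : R :=
  pd a (fun y => Om y b c) x + pd b (fun y => Om y c a) x
  + pd c (fun y => Om y a b) x.

Definition wedge12 th Om x (a b c : 'I_m) : R :=
  th x a 0 * Om x b c + th x b 0 * Om x c a + th x c 0 * Om x a b.

(* A local parametrization, near [x], of an integral manifold of [ker th]
   through [x]. *)
Definition integral_manifold_at (k : nat) (U : set 'rV[R]_m) th x : Prop :=
  exists (W : set 'rV[R]_k) (s : 'rV[R]_k -> 'rV[R]_m),
    [/\ open W, W 0, smooth W s, s 0 = x &
        forall y, W y ->
          [/\ U (s y), injective ('d s y) &
              range ('d s y) = [set v : 'rV[R]_m | v *m th (s y) = 0]]].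

Lemma orthonormal_basis_gram g x E : orthonormal_basis g x E ->
  g x \in unitmx /\ E^T *m E = invmx (g x).
Proof.
rewrite /orthonormal_basis -mulmxA => EgE.
have /mulmx1_unit [Eu _] := EgE.
have : g x *m E^T *m E = 1%:M by apply: mulmx1C; rewrite mulmxA in EgE *.
rewrite -mulmxA => gEE; have [gu _] := mulmx1_unit gEE.
by split=> //; rewrite -[LHS](mulKmx gu) gEE mulmx1.
Qed.

Lemma codiffE g Om x E : orthonormal_basis g x E ->
  codiff g Om x = codiff_in E g Om x.
Proof.
have codiff_gram F : codiff_in F g Om x =
    \col_c - \sum_(a < m) \sum_(b < m) (F^T *m F) a b * nabla2 g Om x a b c.
  apply/colP => c; rewrite !mxE; congr (- _).
  rewrite exchange_big; apply: eq_bigr => a _ /=.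
  rewrite exchange_big; apply: eq_bigr => b _ /=.
  by rewrite mxE mulr_suml; apply: eq_bigr => k _; rewrite !mxE.
move=> EP; rewrite /codiff; case: xgetP => [F _ FP|/(_ E)//].
by rewrite !codiff_gram (orthonormal_basis_gram EP).2
  (orthonormal_basis_gram FP).2.
Qed.

Lemma orthonormal_basis_exists g x : (g x)^T = g x ->
  (forall v : 'rV[R]_m, v != 0 -> 0 < (v *m g x *m v^T) 0 0) ->
  exists E, orthonormal_basis g x E.
Proof.
rewrite /orthonormal_basis; move: (g x) => {g x}; clear.
elim: m => [|k IH]; first by move=> G _ _; exists 0; rewrite !flatmx0.
change (forall G : 'M[R]_(1 + k), G^T = G ->
  (forall v : 'rV[R]_(1 + k), v != 0 -> 0 < (v *m G *m v^T) 0 0) ->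
  exists E : 'M[R]_(1 + k), E *m G *m E^T = 1%:M) => G Gs Gp.
set a := G 0 0; set b := ursubmx G; set D := drsubmx G.
have Gul : ulsubmx G = a%:M.
  by rewrite [LHS]mx11_scalar !mxE; congr (G _ _)%:M; apply/val_inj.
have GE : G = block_mx a%:M b b^T D.
  by rewrite -[LHS]submxK Gul trmx_ursub Gs.
have a_gt0 : 0 < a.
  have /Gp : (delta_mx 0 0 : 'rV[R]_(1 + k)) != 0.
    by apply/eqP => /rowP /(_ 0); rewrite !mxE /= => /eqP; rewrite oner_eq0.
  by rewrite -rowE trmx_delta -colE !mxE.
have Ds : D^T = D by rewrite trmx_drsub Gs.
set q := a^-1; set s := (Num.sqrt a)^-1.
have aq : a * q = 1 by rewrite divff// gt_eqF.
have ssa : s * a * s = 1.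
  by rewrite mulrC mulrA -expr2 exprVn sqr_sqrtr ?ltW// mulVf// gt_eqF.
pose L : 'M[R]_(1 + k) := block_mx s%:M 0 (- q *: b^T) 1%:M.
pose S := D - q *: (b^T *m b).
have LGL : L *m G *m L^T = block_mx 1%:M 0 0 S.
  rewrite GE /L tr_block_mx !mulmx_block !tr_scalar_mx !trmx0 linearZ /= trmxK.
  rewrite !(mul0mx, mulmx0, addr0, mul1mx, mulmx1) -!scalar_mxM ssa.
  rewrite !mul_mx_scalar !mul_scalar_mx !scalerA.
  rewrite !mulrN -!scalemxAl -mulrA aq mulr1 !scaleNr scale1r addNr.
  have -> : - b^T + b^T = 0 by rewrite addrC subrr.
  by rewrite scaler0 mul0mx add0r /S addrC.
have [|w w0|E' E'P] := IH S.
- by rewrite /S linearB linearZ /= trmx_mul trmxK Ds.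
- pose v := row_mx 0 w *m L.
  have v0 : v != 0.
    apply: contra w0 => /eqP; rewrite /v mul_row_block !mul0mx !add0r mulmx1.
    by rewrite -[X in _ = X](@row_mx0 _ 1 1 k) => /eq_row_mx[_ ->].
  have := Gp v v0; rewrite /v trmx_mul !mulmxA -(mulmxA _ L) -(mulmxA _ _ L^T) LGL.
  rewrite tr_row_mx trmx0 mul_row_block.
  by rewrite mul_row_col !(mul0mx, mulmx0, add0r).
- exists (block_mx 1%:M 0 0 E' *m L).
  rewrite trmx_mul !mulmxA -(mulmxA _ L) -(mulmxA _ _ L^T) LGL.
  rewrite tr_block_mx !mulmx_block !(trmx0, trmx1, mul0mx, mulmx0, mul1mx).
  rewrite !(addr0, add0r) mulmx1 E'P !mul0mx; exact/esym/scalar_mx_block.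
Qed.

(* [christoffel_sym] and [nabla2_metric] (no torsion, parallel metric)
   characterize the Levi-Civita connection. *)
Lemma christoffel_sym g x a b d : (\forall y \near x, (g y)^T = g y) ->
  christoffel g x a b d = christoffel g x b a d.
Proof.
move=> gs; rewrite /christoffel; congr (_ * _); apply: eq_bigr => e _.
congr (_ * _); rewrite [X in X - _]addrC; congr (_ - _).
apply: near_eq_derive; near=> y.
by rewrite -[in LHS](near gs y)// mxE.
Unshelve. all: by end_near. Qed.

Lemma nabla2_metric g x a b c : (\forall y \near x, (g y)^T = g y) ->
  g x \in unitmx -> nabla2 g g x a b c = 0.
Proof.
move=> gs gu; have gsx i j : g x i j = g x j i.
  by rewrite -[in LHS](nbhs_singleton gs) mxE.
have pds i j l : pd i (fun y => g y j l) x = pd i (fun y => g y l j) x.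
  apply: near_eq_derive; near=> y; by rewrite -[in LHS](near gs y)// mxE.
have low i j l : \sum_(d < m) christoffel g x i j d * g x d l =
    2^-1 * (pd i (fun y => g y j l) x + pd j (fun y => g y i l) x
     - pd l (fun y => g y i j) x).
  under eq_bigr do rewrite /christoffel -mulrA mulr_suml.
  rewrite -mulr_sumr exchange_big /=; congr (_ * _).
  under eq_bigr => e _.
    under eq_bigr do rewrite mulrAC (mulrC (invmx _ _ _)).
    rewrite -mulr_suml.
    have -> : \sum_(d < m) g x d l * invmx (g x) d e = (e == l)%:R.
      have := congr1 (fun A : 'M[R]_m => A l e) (mulmxV gu).
      rewrite !mxE eq_sym => <-; apply: eq_bigr => d _.
      by rewrite gsx.
    over.
  rewrite (bigD1 l)//= eqxx mul1r big1 ?addr0// => e /negPf ->.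
  by rewrite mul0r.
rewrite /nabla2 low.
under [X in _ - X]eq_bigr do rewrite (gsx b).
rewrite low (pds a c b).
by field.
Unshelve. all: by end_near. Qed.

End LocalCalculus.

Section HermitianGeometry.
Context {R : realType} {n : nat} (M : smooth_manifold R (2 * n + 2)).
Implicit Types (J : endomorphism_field M) (g : riemannian_metric M).
Implicit Types (c : chart R (2 * n + 2) M) (x : 'rV[R]_(2 * n + 2)).

Definition complex_structure J : Prop :=
  forall c, atlas M c ->
    (forall x, cod c x -> J c x *m J c x = - 1%:M) /\
    (forall X Y, smooth (cod c) X -> smooth (cod c) Y ->
       forall x, cod c x -> nijenhuis (J c) X Y x = 0).

Definition hermitian J g : Prop :=
  complex_structure J /\
  forall c, atlas M c -> forall x, cod c x ->
    J c x *m g c x *m (J c x)^T = g c x.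

Definition Omega J g c : 'rV[R]_(2 * n + 2) -> 'M[R]_(2 * n + 2) :=
  fundamental_form (g c) (J c).

Definition anti_lee_form J g c x : 'cV[R]_(2 * n + 2) :=
  n%:R^-1 *: codiff (g c) (Omega J g c) x.

(* [theta (X) = eta (J X)] *)
Definition lee_form J g c x : 'cV[R]_(2 * n + 2) :=
  J c x *m anti_lee_form J g c x.

(* The vector [V] with [g (V, X) = eta (X)] for all [X]. *)
Definition anti_lee_vector J g c x : 'rV[R]_(2 * n + 2) :=
  (invmx (g c x) *m anti_lee_form J g c x)^T.

Definition lck J g : Prop :=
  hermitian J g /\
  forall c, atlas M c -> forall x, cod c x ->
    (forall a b d, d2 (Omega J g c) x a b d =
                   wedge12 (lee_form J g c) (Omega J g c) x a b d) /\
    (forall a b, d1 (lee_form J g c) x a b = 0).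

Definition globally_conformal_kahler J g : Prop :=
  exists f : M -> R, forall c, atlas M c ->
    smooth (cod c) (f \o param c) /\
    forall x, cod c x -> forall a,
      lee_form J g c x a 0 = pd a (f \o param c) x.

(* Integrability of a distribution: an integral manifold passes through every
   point; a small one lies in the domain of a chart. *)
Definition integrable_lck J g : Prop :=
  [/\ lck J g,
      forall c, atlas M c -> forall x, cod c x -> anti_lee_vector J g c x != 0 &
      forall c, atlas M c -> forall x, cod c x ->
        integral_manifold_at (2 * n + 1) (cod c) (anti_lee_form J g c) x].

End HermitianGeometry.

(* Main.v *)
From HB Require Import structures.
Require Import Defs.
From mathcomp Require Import all_boot all_order all_algebra.
From mathcomp Require Import all_classical all_reals all_analysis.
From mathcomp Require Import ring lra.

(** The example is the product M of the punctured complex line and C^n, with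
    coordinates p_0 <> 0, p_1, ..., p_n, its standard complex structure J, and
    the metric g = sum_k |phi_k|^2 where
<<
      phi_k = p_0 dp_k + (1 + i) p_k dp_0 = p_0^(-i) d(p_0^(1 + i) p_k).
>>
    Where a branch of arg p_0 is chosen, g is exp (2 arg p_0) times the pull-back
    of the flat Kaehler metric by the local biholomorphism
    p |-> (p_0^(1 + i) p_k)_k.  So Omega satisfies dOmega = theta /\ Omega for
    theta = 2 d(arg p_0), a closed form that is defined on all of M.  The
    exponent 1 + i is used instead of i so that the phi_k, hence g, are
    polynomial.

    Three properties remain.  The form theta is not exact, because a primitive
    would increase strictly along each side of a square around p_0 = 0
    ([theta_not_exact]).  The anti-Lee form is eta = - 2 d(log |p_0|), which
    vanishes nowhere.  Its kernel is tangent to the hypersurfaces on which |p_0|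
    is constant, which are parametrized by rotating p_0
    ([circle_integral_manifold]).

    That theta is the Lee form needs the codifferential of Omega, which is
    defined through the Levi-Civita connection of g.  It is obtained without
    inverting g: for every constant almost complex structure J that is
    orthogonal for g and every 1-form theta with dOmega = theta /\ Omega,
    contracting this equation with the bivector g^-1 J gives delta Omega = - n J theta ([codiff_lck]).  The equation
    dOmega = theta /\ Omega itself is a sum over k of identities in the real and
    imaginary parts of phi_k ([structure_equation]). *)

Set Implicit Arguments.
Unset Strict Implicit.
Unset Printing Implicit Defensive.

Import Order.TTheory GRing.Theory Num.Theory.
Import numFieldNormedType.Exports.

Local Open Scope classical_set_scope.
Local Open Scope ring_scope.

(** * Functions that are smooth on an open set *)

Lemma open_near (T : topologicalType) (A : set T) (P : T -> Prop) (x : T) :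
  open A -> A x -> (forall y, A y -> P y) -> \forall y \near x, P y.
Proof.
move=> oA Ax AP; have : nbhs x A by exact: open_nbhs_nbhs.
exact: filterS.
Qed.

Lemma continuous_eq_on (T S : topologicalType) (A : set T) (f g : T -> S) (x : T) :
  open A -> (forall y, A y -> f y = g y) -> A x ->
  {for x, continuous f} -> {for x, continuous g}.
Proof.
move=> oA fg Ax cf; change (g @ x --> g x); rewrite -(fg _ Ax).
apply: cvg_trans cf; apply: near_eq_cvg; exact: open_near fg.
Qed.

Section SmoothFunctions.
Context {R : realType} {k : nat}.
Implicit Types (U : set 'rV[R]_k).

Lemma Cn_eq {W : normedModType R} N U (f g : 'rV[R]_k -> W) :
  open U -> (forall x, U x -> f x = g x) -> Cn N U f -> Cn N U g.
Proof.
move=> oU; elim: N f g => [|N IH] f g fg [cf Hf].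
  by split=> // x Ux; exact: continuous_eq_on oU fg Ux (cf x Ux).
split; first by move=> x Ux; exact: continuous_eq_on oU fg Ux (cf x Ux).
move=> a; have [df Cf] := Hf a; split=> [x Ux|].
  by apply: near_eq_derivable (df x Ux); apply: open_near Ux _.
apply: IH Cf => x Ux; apply: near_eq_derive.
by apply: open_near Ux _.
Qed.

Lemma Cn_cst {W : normedModType R} N U (w : W) : open U -> Cn N U (cst w).
Proof.
move=> oU; elim: N w => [|N IH] w; split=> //.
- by move=> x _; exact: cst_continuous.
- by move=> x _; exact: cst_continuous.
- move=> a; split=> [x _|]; first exact: derivable_cst.
  by apply: (@Cn_eq _ _ _ (cst 0)) (IH _) => // x _; rewrite /pd derive_cst.
Qed.

Lemma is_derive_coord (i : 'I_k) (x v : 'rV[R]_k) :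
  is_derive x v (fun y : 'rV[R]_k => y 0 i) (v 0 i).
Proof.
have d : differentiable (fun y : 'rV[R]_k => y 0 i) x.
  exact: differentiable_coord.
apply: DeriveDef; first exact: diff_derivable.
rewrite deriveE//.
have lin : linear (fun y : 'rV[R]_k => y 0 i : R) by move=> c u w; rewrite !mxE.
pose L := GRing.isLinear.Build R 'rV[R]_k R _ (fun y : 'rV[R]_k => y 0 i) lin.
pose f : {linear 'rV[R]_k -> R} := HB.pack (fun y : 'rV[R]_k => y 0 i) L.
by rewrite (@diff_lin _ _ _ f)//; exact: coord_continuous.
Qed.

Lemma pd_val {W : normedModType R} (f : 'rV[R]_k -> W) a x df :
  is_derive x (delta_mx 0 a) f df -> pd a f x = df.
Proof. by move=> fdf; rewrite /pd derive_val. Qed.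

Lemma Cn_coord N U (i : 'I_k) : open U -> Cn N U (fun y : 'rV[R]_k => y 0 i).
Proof.
move=> oU; case: N => [|N]; split=> //.
- by move=> x _; exact: coord_continuous.
- by move=> x _; exact: coord_continuous.
- move=> a; split=> [x _|]; first exact: (@ex_derive _ _ _ _ _ _ _ (is_derive_coord i x _)).
  apply: (@Cn_eq _ _ _ (cst ((delta_mx 0 a : 'rV[R]_k) 0 i))) (Cn_cst _ _ _) => // x _.
  by rewrite (pd_val (is_derive_coord i x _)).
Qed.

Lemma CnD {W : normedModType R} N U (f g : 'rV[R]_k -> W) :
  open U -> Cn N U f -> Cn N U g -> Cn N U (fun x => f x + g x).
Proof.
move=> oU; elim: N f g => [|N IH] f g [cf Hf] [cg Hg].
  by split=> // x Ux; apply: continuousD; [exact: cf|exact: cg].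
split=> [x Ux|a]; first by apply: continuousD; [exact: cf|exact: cg].
have [df Cf] := Hf a; have [dg Cg] := Hg a; split=> [x Ux|].
  by apply: derivableD; [exact: df|exact: dg].
apply: Cn_eq (IH _ _ Cf Cg) => // x Ux.
by rewrite /pd (deriveD (df _ Ux) (dg _ Ux)).
Qed.

Lemma CnN {W : normedModType R} N U (f : 'rV[R]_k -> W) :
  open U -> Cn N U f -> Cn N U (fun x => - f x).
Proof.
move=> oU; elim: N f => [|N IH] f [cf Hf].
  by split=> // x Ux; apply: continuousN; exact: cf.
split=> [x Ux|a]; first by apply: continuousN; exact: cf.
have [df Cf] := Hf a; split=> [x Ux|]; first by apply: derivableN; exact: df.
by apply: Cn_eq (IH _ Cf) => // x Ux; rewrite /pd (deriveN (df _ Ux)).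
Qed.

Lemma Cn_le {W : normedModType R} N U (f : 'rV[R]_k -> W) :
  Cn N.+1 U f -> Cn N U f.
Proof.
elim: N f => [|N IH] f [cf Hf]; split=> //.
by move=> a; have [df Cf] := Hf a; split=> //; exact: IH.
Qed.

Lemma CnM N U (f g : 'rV[R]_k -> R) :
  open U -> Cn N U f -> Cn N U g -> Cn N U (fun x => f x * g x).
Proof.
move=> oU; elim: N f g => [|N IH] f g Cf Cg.
  by case: Cf Cg => cf _ [cg _]; split=> // x Ux; apply: continuousM; [exact: cf|exact: cg].
have [[cf Hf] [cg Hg]] := (Cf, Cg).
split=> [x Ux|a]; first by apply: continuousM; [exact: cf|exact: cg].
have [df Cf'] := Hf a; have [dg Cg'] := Hg a; split=> [x Ux|].
  by apply: derivableM; [exact: df|exact: dg].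
have := CnD oU (IH _ _ (Cn_le Cf) Cg') (IH _ _ (Cn_le Cg) Cf').
by apply: Cn_eq => // x Ux; rewrite /pd (deriveM (df _ Ux) (dg _ Ux)).
Qed.

Lemma Cn_sum {W : normedModType R} N U (I : finType) (f : I -> 'rV[R]_k -> W) :
  open U -> (forall i, Cn N U (f i)) -> Cn N U (fun x => \sum_i f i x).
Proof.
move=> oU Cf; elim: (index_enum I) => [|i r IH].
  by apply: Cn_eq (Cn_cst N 0 oU) => // x _; rewrite big_nil.
by apply: Cn_eq (CnD oU (Cf i) IH) => // x _; rewrite big_cons.
Qed.

Lemma mx_continuous (T : topologicalType) m n (f : T -> 'M[R]_(m, n)) (x : T) :
  (forall i j, {for x, continuous (fun y => f y i j)}) -> {for x, continuous f}.
Proof.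
move=> cf; apply/cvgrPdist_le => /= e e0.
near=> y.
rewrite /Num.Def.normr/= mx_normrE (bigmax_le _ (ltW e0))//= => i _.
rewrite !mxE/=; move: i; near: y; apply: filter_forall => /= i.
exact: ((cvgrPdist_le _ _).1 (cf i.1 i.2)).
Unshelve. all: by end_near. Qed.

Lemma Cn_mx N U m n (f : 'rV[R]_k -> 'M[R]_(m, n)) :
  open U -> (forall i j, Cn N U (fun x => f x i j)) -> Cn N U f.
Proof.
move=> oU; elim: N f => [|N IH] f Cf.
  by split=> // x Ux; apply: mx_continuous => i j; exact: (Cf i j).1.
split=> [x Ux|a]; first by apply: mx_continuous => i j; exact: (Cf i j).1.
have df x : U x -> derivable f x (delta_mx 0 a).
  by move=> Ux; apply/derivable_mxP => i j; exact: ((Cf i j).2 a).1.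
split=> //; apply: IH => i j; apply: Cn_eq ((Cf i j).2 a).2 => // x Ux.
by rewrite /pd derive_mx ?mxE//; exact: df.
Qed.

Lemma is_derive_comp1 (f : R -> R) (i : 'I_k) (x v : 'rV[R]_k) (df : R) :
  is_derive (x 0 i) 1 f df ->
  is_derive x v (fun y : 'rV[R]_k => f (y 0 i)) (v 0 i * df).
Proof.
move=> fd.
have f_diff : differentiable f (x 0 i) by apply/derivable1_diffP.
have c_diff : differentiable (fun y : 'rV[R]_k => y 0 i : R) x.
  exact: differentiable_coord.
apply: DeriveDef; first by apply: diff_derivable; exact: differentiable_comp.
rewrite deriveE; last exact: differentiable_comp.
rewrite (@diff_comp _ _ _ _ (fun y : 'rV[R]_k => y 0 i : R) f)//=.
rewrite -(@deriveE _ _ _ (fun y : 'rV[R]_k => y 0 i : R))//.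
rewrite (@derive_val _ _ _ _ _ _ _ (is_derive_coord i x v)).
rewrite -[X in 'd _ _ X]mulr1 [LHS]linearZ /= -deriveE//.
by rewrite (@derive_val _ _ _ _ _ _ _ fd).
Qed.

(** Up to sign each of the two functions is the derivative of the other, so they are
    treated by one induction. *)
Lemma Cn_cos_sin N (i : 'I_k) :
  Cn N setT (fun y : 'rV[R]_k => cos (y 0 i)) /\
  Cn N setT (fun y : 'rV[R]_k => sin (y 0 i)).
Proof.
have cc x : {for x, continuous (fun y : 'rV[R]_k => cos (y 0 i))}.
  by apply: continuous_comp; [exact: coord_continuous|exact: continuous_cos].
have cs x : {for x, continuous (fun y : 'rV[R]_k => sin (y 0 i))}.
  by apply: continuous_comp; [exact: coord_continuous|exact: continuous_sin].
elim: N => [|N [IHc IHs]]; first by [].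
split; split=> // a; split.
- by move=> x _; apply: (@ex_derive _ _ _ _ _ _ _ (is_derive_comp1 _ (is_derive_cos _))).
- apply: Cn_eq (CnM openT (Cn_cst N ((delta_mx 0 a : 'rV[R]_k) 0 i) openT) (CnN openT IHs)).
    exact: openT.
  by move=> x _; rewrite (pd_val (is_derive_comp1 _ (is_derive_cos _))).
- by move=> x _; apply: (@ex_derive _ _ _ _ _ _ _ (is_derive_comp1 _ (is_derive_sin _))).
- apply: Cn_eq (CnM openT (Cn_cst N ((delta_mx 0 a : 'rV[R]_k) 0 i) openT) IHc).
    exact: openT.
  by move=> x _; rewrite (pd_val (is_derive_comp1 _ (is_derive_sin _))).
Qed.

End SmoothFunctions.

(** * Open subsets of Euclidean space as manifolds with one chart *)

(** The differential is determined by the first-order expansion at [x], which only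
    sees [f] near [x]. *)
Lemma near_eq_diff {R : realType} (V W : normedModType R) (f g : V -> W) (x : V) :
  (\forall y \near x, f y = g y) -> differentiable g x -> 'd f x = 'd g x :> (V -> W).
Proof.
move=> fg dg; apply: diff_unique; first exact: diff_continuous.
have /eqaddoP H := diff_locally dg; apply/eqaddoP => e e0.
have : \forall h \near 0, f (h + x) = g (h + x).
  by move: fg; rewrite (near_shift 0) /=; apply: filterS => h /=; rewrite subr0.
move: (H e e0); apply: filterS2 => h /= + hx.
by rewrite !fctE /= hx (nbhs_singleton fg).
Qed.

Section OpenSubmanifold.
Context {R : realType} {m : nat}.

Lemma rV_hausdorff : hausdorff_space 'rV[R]_m.
Proof. exact: norm_hausdorff. Qed.

(** Rational points are dense, so the balls with rational centre and radius of the
    form 1/(n+1) form a basis. *)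
Lemma rV_second_countable : @second_countable 'rV[R]_m.
Proof.
pose rb (p : 'rV[rat]_m * nat) : set 'rV[R]_m :=
  ball (\row_i ratr (p.1 0 i) : 'rV[R]_m) p.2.+1%:R^-1.
exists (range rb).
  exact: (card_le_trans (card_image_le _ _) (countableP _)).
split=> [_ [p _ <-]|x A]; first exact: ball_open.
move=> /nbhs_ballP[e /= e0 xeA].
have [n] := ltr_add_invr (divr_gt0 e0 (ltr0n R 2) : 0 < e / 2).
rewrite add0r => ne; have n0 : 0 < n.+1%:R^-1 :> R by rewrite invr_gt0.
have xq i : exists q : rat, `|ratr q - x 0 i| < n.+1%:R^-1.
  have [q] : exists q, (ratr q : R) \in `](x 0 i - n.+1%:R^-1), (x 0 i + n.+1%:R^-1)[.
    by apply: rat_in_itvoo; rewrite ltrBlDr -addrA ltrDl addr_gt0.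
  by rewrite in_itv /= => qx; exists q; rewrite distrC ltr_distlC.
have [q {}xq] := choice xq.
have rbx : rb (\row_i q i, n) x.
  by split=> // i j; rewrite ord1 !mxE /ball/= xq.
exists (rb (\row_i q i, n)) => /=; first by split=> //; exists (\row_i q i, n).
move=> y qy; apply: xeA; rewrite (splitr e).
pose z : 'rV[R]_m := \row_i ratr ((\row_i q i : 'rV[rat]_m) 0 i).
apply: (@ball_triangle _ _ z).
  exact: (ball_sym (le_ball (ltW ne) rbx)).
exact: le_ball (ltW ne) _ qy.
Qed.

Variables (U : set 'rV[R]_m) (oU : open U) (x0 : 'rV[R]_m) (Ux0 : U x0).

Lemma sub_hausdorff : hausdorff_space U.
Proof.
rewrite open_hausdorff => p q pq.
have : \val p != \val q by apply: contra pq => /eqP/val_inj ->.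
have := rV_hausdorff; rewrite open_hausdorff => /[apply].
move=> [[A B] /= [pA qB] [oA oB AB]].
exists (val @^-1` A, val @^-1` B) => /=.
  by split; rewrite inE /= -in_setE.
split; [by exists A|by exists B|].
by rewrite -preimage_setI (eqP AB) preimage_set0.
Qed.

Lemma sub_second_countable : @second_countable U.
Proof.
have [B cB [Bo Bb]] := rV_second_countable.
exists [set (val : U -> _) @^-1` A | A in B].
  exact: (card_le_trans (card_image_le _ _) cB).
split=> [_ [A /Bo oA <-]|p A]; first by exists A.
rewrite nbhsE => -[_ [[C oC <-] Cp] CA].
have [D [BD Dp] DC] := Bb (\val p) C (open_nbhs_nbhs (conj oC Cp)).
exists (val @^-1` D) => /=; first by split=> //; exists D.
by move=> q Dq; apply: CA; exact: DC.
Qed.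

(** The inverse of the inclusion, extended off [U] by the constant [x0]. *)
Definition sub_param (x : 'rV[R]_m) : U := insubd (SigSub (mem_set Ux0)) x.

Lemma sub_paramK (x : 'rV[R]_m) : U x -> \val (sub_param x) = x.
Proof. by move=> Ux; rewrite /sub_param insubdK// inE. Qed.

Lemma sub_crd_cod : val @` [set: U] = U.
Proof.
apply/seteqP; split=> [_ [p _ <-]|x Ux]; first exact/set_mem/(valP p).
by exists (sub_param x) => //; exact: sub_paramK.
Qed.

Lemma sub_crd_open : open (val @` [set: U]).
Proof. by rewrite sub_crd_cod. Qed.

Lemma sub_crdK (p : U) : [set: U] p -> sub_param (\val p) = p.
Proof. by move=> _; apply: val_inj; rewrite sub_paramK//; exact/set_mem/(valP p). Qed.

Lemma sub_crd_continuous (p : U) :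
  [set: U] p -> {for p, continuous (val : U -> 'rV[R]_m)}.
Proof. by move=> _; exact: initial_continuous. Qed.

Lemma sub_param_continuous (x : 'rV[R]_m) :
  (val @` [set: U]) x -> {for x, continuous sub_param}.
Proof.
rewrite sub_crd_cod => Ux A.
rewrite nbhsE => -[_ [[C oC <-] Cp] CA].
have {}Cp : C x by rewrite -(sub_paramK Ux).
have : nbhs x (U `&` C) by apply: open_nbhs_nbhs; split=> //; exact: openI.
apply: filterS => y [Uy Cy]; apply: CA.
by change (C (\val (sub_param y))); rewrite sub_paramK.
Qed.

Definition sub_chart : chart R m U :=
  Chart openT sub_crd_open sub_crdK sub_crd_continuous sub_param_continuous.

Lemma sub_cod : cod sub_chart = U.
Proof. exact: sub_crd_cod. Qed.

Lemma sub_overlap : overlap sub_chart sub_chart = U.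
Proof. by rewrite -[RHS]sub_cod /overlap setIid. Qed.

Lemma sub_transitionE (x : 'rV[R]_m) :
  U x -> transition sub_chart sub_chart x = x.
Proof. exact: sub_paramK. Qed.

Lemma sub_compatible (c c' : chart R m U) :
  [set sub_chart] c -> [set sub_chart] c' ->
  smooth (overlap c c') (transition c c').
Proof.
move=> -> -> N; rewrite sub_overlap; apply: Cn_mx => // i j.
apply: Cn_eq (Cn_coord N j oU) => // x Ux; rewrite sub_transitionE//.
by rewrite (ord1 i).
Qed.

Lemma sub_atlas_cover (p : U) : exists2 c, [set sub_chart] c & dom c p.
Proof. by exists sub_chart. Qed.

Definition open_submanifold : smooth_manifold R m :=
  SmoothManifold sub_hausdorff sub_second_countable sub_atlas_cover sub_compatible.

Lemma sub_jacobian (x : 'rV[R]_m) :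
  U x -> 'J (transition sub_chart sub_chart) x = 1%:M.
Proof.
move=> Ux.
have near_id : \forall y \near x, transition sub_chart sub_chart y = y.
  by apply: open_near Ux _ => // y; exact: sub_transitionE.
rewrite /jacobian; apply/row_matrixP => i; rewrite !rowE mul_rV_lin1 /= mulmx1.
rewrite (near_eq_diff near_id)//; first by rewrite diff_val.
Qed.

End OpenSubmanifold.

(** * Constant almost complex structures have no torsion *)

Section ConstantEndomorphism.
Context {R : realType} {m : nat}.

Lemma Cn_mulmxr N (J : 'M[R]_m) : Cn N setT (fun v : 'rV[R]_m => v *m J).
Proof.
have oT := @openT 'rV[R]_m; apply: Cn_mx => // i j.
apply: (Cn_eq (f := fun v => \sum_k v 0 k * J k j)) => //.
  by move=> x _; rewrite (ord1 i) mxE.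
apply: Cn_sum => // k; apply: CnM => //; first exact: Cn_coord.
exact: (Cn_cst N (J k j)).
Qed.

Lemma lim_mulmxr (T : Type) (F : set_system T) (J : 'M[R]_m) (q : T -> 'rV[R]_m) :
  ProperFilter F -> cvg (q @ F) ->
  lim ((fun t => q t *m J) @ F) = lim (q @ F) *m J.
Proof.
move=> FF cq; apply: cvg_lim => //.
exact: (cvg_comp _ _ cq ((Cn_mulmxr 0 J).1 _ I)).
Qed.

(** Right multiplication by an invertible matrix is a homeomorphism, so the two
    difference quotients converge together; when they diverge, both limits are [0]
    by convention. *)
Lemma derive_mulmxr (J : 'M[R]_m) (Y : 'rV[R]_m -> 'rV[R]_m) (v x : 'rV[R]_m) :
  J \in unitmx -> 'D_v (fun y => Y y *m J) x = 'D_v Y x *m J.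
Proof.
move=> Ju; rewrite /derive.
pose q (h : R) := h^-1 *: ((Y \o shift x) (h *: v) - Y x).
have qJ : (fun h => h^-1 *: (((fun y => Y y *m J) \o shift x) (h *: v) - Y x *m J))
    = (fun h => q h *m J).
  by apply/funext => h; rewrite /q /= -mulmxBl scalemxAl.
rewrite qJ -/q; have [cq|dq] := pselect (cvg (q @ 0^')).
  exact: lim_mulmxr.
rewrite (dvgP dq) dvgP => [|cqJ].
  by rewrite (_ : point = 0) ?mul0mx//; apply/rowP => i; rewrite !mxE.
apply: dq; have -> : q = fun h => (q h *m J) *m invmx J.
  by apply/funext => h; rewrite mulmxK.
apply/cvg_ex; eexists.
exact: (cvg_comp _ _ cqJ ((Cn_mulmxr 0 (invmx J)).1 _ I)).
Qed.

(** By [derive_mulmxr] a constant [J] passes through all the derivatives in the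
    torsion, which then cancel in pairs. *)
Lemma nijenhuis_cst (J : 'M[R]_m) (X Y : 'rV[R]_m -> 'rV[R]_m) x :
  J *m J = - 1%:M -> nijenhuis (cst J) X Y x = 0.
Proof.
move=> JJ; have Ju : J \in unitmx.
  by have /mulmx1_unit[] : J *m - J = 1%:M by rewrite mulmxN JJ opprK.
rewrite /nijenhuis /lie_bracket /app_endo /= !derive_mulmxr// !mulmxBl.
rewrite -!mulmxA JJ !mulmxN !mulmx1.
have zmod (a b c d : 'rV[R]_m) : a - b - (a - - d) - (- c - b) - (c - d) = 0.
  by apply/rowP => i; rewrite !mxE; ring.
exact: zmod.
Qed.

End ConstantEndomorphism.

(** * The codifferential of the fundamental form *)

Section Codifferential.
Context {R : realType} {m : nat}.

Lemma sum_mulmx (F : pzSemiRingType) (p q r : nat) (A : 'M[F]_(p, q)) (B : 'M[F]_(q, r)) i j :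
  \sum_k A i k * B k j = (A *m B) i j.
Proof. by rewrite mxE. Qed.

Section Algebra.
Variables (J G : 'M[R]_m) (dg : 'I_m -> 'M[R]_m) (th : 'cV[R]_m).
Hypotheses (Gu : G \in unitmx) (GT : G^T = G) (JJ : J *m J = - 1%:M).
Hypotheses (JGJ : J *m G *m J^T = G).
Hypotheses (dgT : forall a, (dg a)^T = dg a).
Hypotheses (JdgJ : forall a, J *m dg a *m J^T = dg a).

(* [L], [chr] and [nab] are the Christoffel symbols of the first and second kind
   and the covariant derivative of [Om]. *)
Let Gi := invmx G.
Let K := Gi *m J.
Let Om := G *m J^T.
Let dOm a := dg a *m J^T.
Let L a b e := 2^-1 * (dg a b e + dg b a e - dg e a b).
Let chr a b d := 2^-1 * \sum_e Gi d e * (dg a b e + dg b a e - dg e a b).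
Let nab a b c := dOm a b c - \sum_d chr a b d * Om d c - \sum_d chr a c d * Om b d.
Let tau e := \sum_a \sum_b Gi a b * dg e a b.
Let S c := \sum_a \sum_e K a e * dg a c e.

Let dgs a b c : dg a b c = dg a c b.
Proof. by rewrite -[in LHS]dgT mxE. Qed.

Let GiT : Gi^T = Gi.
Proof. by rewrite /Gi trmx_inv GT. Qed.

Let Gis a b : Gi a b = Gi b a.
Proof. by rewrite -[in LHS]GiT mxE. Qed.

Let JTJT : J^T *m J^T = - 1%:M.
Proof. by rewrite -trmx_mul JJ linearN /= trmx1. Qed.

Let JA (A : 'M[R]_m) : J *m A *m J^T = A -> J *m A = - (A *m J^T).
Proof. by move=> {2}<-; rewrite -mulmxA JTJT mulmxN mulmx1 opprK. Qed.

Let OmT : Om^T = - Om.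
Proof. by rewrite /Om trmx_mul trmxK GT JA. Qed.

Let Oms a b : Om a b = - Om b a.
Proof. by rewrite -[in LHS](opprK Om) -OmT !mxE. Qed.

Let dOms a b c : dOm a b c = - dOm a c b.
Proof.
suff H : (dOm a)^T = - dOm a by rewrite -[in LHS](opprK (dOm a)) -H !mxE.
by rewrite /dOm trmx_mul trmxK dgT JA.
Qed.

Let KT : K^T = - K.
Proof.
rewrite /K trmx_mul GiT.
have -> : J^T *m Gi = Gi *m (G *m J^T) *m Gi by rewrite mulmxA mulVmx// mul1mx.
have -> : G *m J^T = - (J *m G) by rewrite JA// opprK.
by rewrite mulmxN mulNmx -!mulmxA mulmxV// mulmx1.
Qed.

Let Ks a b : K a b = - K b a.
Proof. by rewrite -[in LHS](opprK K) -KT !mxE. Qed.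

Let chrE a b d : chr a b d = ((\row_e L a b e) *m Gi) 0 d.
Proof.
rewrite mxE /chr mulr_sumr; apply: eq_bigr => e _.
by rewrite mxE /L (Gis d e); ring.
Qed.

Let nabE a b c :
  nab a b c = \sum_e J c e * (dg a b e - L a b e) + \sum_e J b e * L a c e.
Proof.
rewrite /nab.
under eq_bigr do rewrite chrE.
under [X in _ - X]eq_bigr do rewrite chrE Oms mulrN.
rewrite sumrN opprK !sum_mulmx /Om -!mulmxA !(mulmxA Gi) mulVmx// !mul1mx.
rewrite /dOm !mxE -sumrB; congr (_ + _); apply: eq_bigr => e _; rewrite !mxE.
  by rewrite mulrBr !(mulrC (J c e)).
by rewrite mulrC.
Qed.

(* The two sums in [nabE] contracted with the inverse metric: by the symmetry of
   [Gi] the first keeps only the trace [tau], by the antisymmetry of [K] the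
   second keeps only [S]. *)
Let S1E c : \sum_a \sum_b Gi a b * (\sum_e J c e * (dg a b e - L a b e)) =
  2^-1 * \sum_e J c e * tau e.
Proof.
under eq_bigr => a _.
  under eq_bigr => b _ do rewrite mulr_sumr.
  rewrite exchange_big /=.
  over.
rewrite exchange_big /= mulr_sumr; apply: eq_bigr => e _.
have sw : \sum_a \sum_b Gi a b * dg b a e = \sum_a \sum_b Gi a b * dg a b e.
  by rewrite exchange_big; apply: eq_bigr => a _; apply: eq_bigr => b _; rewrite Gis.
transitivity (J c e * 2^-1 * (\sum_a \sum_b Gi a b * dg a b e
   - \sum_a \sum_b Gi a b * dg b a e + tau e)); last first.
  by rewrite sw subrr add0r; ring.
rewrite -sumrB -big_split mulr_sumr; apply: eq_bigr => a _ /=.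
rewrite -sumrB -big_split mulr_sumr; apply: eq_bigr => b _ /=.
by rewrite /L; field.
Qed.

Let S2E c : \sum_a \sum_b Gi a b * (\sum_e J b e * L a c e) = S c.
Proof.
transitivity (\sum_a \sum_e K a e * L a c e).
  apply: eq_bigr => a _.
  under eq_bigr do rewrite mulr_sumr.
  rewrite exchange_big; apply: eq_bigr => e _ /=.
  by rewrite /K mxE mulr_suml; apply: eq_bigr => b _; rewrite mulrA.
have z : \sum_a \sum_e K a e * dg c a e = 0.
  have : \sum_a \sum_e K a e * dg c a e = - \sum_a \sum_e K a e * dg c a e.
    rewrite -sumrN exchange_big; apply: eq_bigr => a _ /=; rewrite -sumrN.
    by apply: eq_bigr => e _; rewrite Ks dgs mulNr.
  by move=> h; lra.
have sw : \sum_a \sum_e K a e * dg e a c = - S c.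
  rewrite /S -sumrN exchange_big; apply: eq_bigr => a _ /=; rewrite -sumrN.
  by apply: eq_bigr => e _; rewrite Ks dgs mulNr.
transitivity (2^-1 * (S c + \sum_a \sum_e K a e * dg c a e -
  \sum_a \sum_e K a e * dg e a c)); last by rewrite z sw; field.
rewrite /S -big_split -sumrB mulr_sumr; apply: eq_bigr => a _ /=.
rewrite -big_split -sumrB mulr_sumr; apply: eq_bigr => e _ /=.
by rewrite /L; field.
Qed.

Let dOm_contract c : \sum_d J c d *
    (\sum_a \sum_b K a b * (dOm a b d + dOm b d a + dOm d a b)) =
  - (2 * S c) - \sum_d J c d * tau d.
Proof.
pose T d := \sum_a \sum_b K a b * dOm a b d.
have e1 d : \sum_a \sum_b K a b * (dOm a b d + dOm b d a + dOm d a b) =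
    2 * T d - tau d.
  have t2 : \sum_a \sum_b K a b * dOm b d a = T d.
    rewrite /T exchange_big; apply: eq_bigr => a _; apply: eq_bigr => b _ /=.
    by rewrite Ks dOms mulrNN.
  have t3 : \sum_a \sum_b K a b * dOm d a b = - tau d.
    rewrite /tau -sumrN; apply: eq_bigr => a _; rewrite -sumrN.
    transitivity ((K *m J *m dg d) a a).
      rewrite -mulmxA JA ?JdgJ// mulmxN !mxE -sumrN; apply: eq_bigr => b _.
      by rewrite dOms mulrN.
    rewrite /K -(mulmxA Gi) JJ mulmxN mulmx1 mulNmx !mxE -sumrN.
    by apply: eq_bigr => b _; rewrite (dgs d a b).
  rewrite mulr_natl mulr2n -{2}t2 -t3 /T -!big_split; apply: eq_bigr => a _ /=.
  by rewrite -!big_split; apply: eq_bigr => b _ /=; ring.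
under eq_bigr do rewrite e1 mulrBr.
rewrite sumrB; congr (_ - _).
transitivity (2 * \sum_a \sum_b K a b * \sum_d (dOm a b d * J c d)).
  rewrite mulr_sumr.
  under [RHS]eq_bigr => a _.
    rewrite mulr_sumr.
    under eq_bigr => b _ do rewrite !mulr_sumr.
    rewrite exchange_big /=; over.
  rewrite exchange_big /=; apply: eq_bigr => d _.
  rewrite /T !mulr_sumr; apply: eq_bigr => a _; rewrite !mulr_sumr.
  by apply: eq_bigr => b _; ring.
rewrite -mulrN /S; congr (2 * _); rewrite -sumrN; apply: eq_bigr => a _.
rewrite -sumrN; apply: eq_bigr => b _; rewrite -mulrN; congr (_ * _).
transitivity ((dOm a *m J^T) b c).
  by rewrite mxE; apply: eq_bigr => d _; rewrite !mxE.
by rewrite /dOm -mulmxA JTJT mulmxN mulmx1 mxE dgs.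
Qed.

Let wedge_contract d :
  \sum_a \sum_b K a b * (th a 0 * Om b d + th b 0 * Om d a + th d 0 * Om a b) =
  (2 - m%:R) * th d 0.
Proof.
have KOm : K *m Om = 1%:M by rewrite /K /Om -mulmxA (mulmxA J) JGJ mulVmx.
have t1 : \sum_a \sum_b K a b * (th a 0 * Om b d) = th d 0.
  transitivity (\sum_a th a 0 * (a == d)%:R); last first.
    rewrite (bigD1 d)//= eqxx mulr1 big1 ?addr0// => a /negPf ->.
    by rewrite mulr0.
  apply: eq_bigr => a _.
  have := sum_mulmx K Om a d; rewrite KOm !mxE => <-.
  by rewrite mulr_sumr; apply: eq_bigr => b _; ring.
have t2 : \sum_a \sum_b K a b * (th b 0 * Om d a) = th d 0.
  rewrite -{}t1 exchange_big; apply: eq_bigr => a _; apply: eq_bigr => b _ /=.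
  by rewrite Ks (Oms d); ring.
have t3 : \sum_a \sum_b K a b * Om a b = - m%:R.
  rewrite -(mxtrace1 R m) -KOm /mxtrace -sumrN; apply: eq_bigr => a _.
  by rewrite mxE -sumrN; apply: eq_bigr => b _; rewrite (Oms a b) mulrN.
transitivity (\sum_a \sum_b K a b * (th a 0 * Om b d) +
    \sum_a \sum_b K a b * (th b 0 * Om d a) +
    (\sum_a \sum_b K a b * Om a b) * th d 0); last by rewrite t1 t2 t3; ring.
rewrite mulr_suml -!big_split; apply: eq_bigr => a _ /=.
by rewrite mulr_suml -!big_split; apply: eq_bigr => b _ /=; ring.
Qed.

(** The codifferential of [Om = G J^T] in terms of its exterior derivative, at one
    point: [G] is the metric and [dg a] its derivative along the [a]-th axis.
    With [K = G^-1 J], contracting [dOm] with [K] in its first two indices and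
    with [J] in the third gives twice the codifferential ([dOm_contract]), while
    the same contraction of [th /\ Om] gives [(2 - m) J th]
    ([wedge_contract]). *)
Lemma divergence_contract :
  (forall a b c, dOm a b c + dOm b c a + dOm c a b =
     th a 0 * Om b c + th b 0 * Om c a + th c 0 * Om a b) ->
  forall c, - (\sum_a \sum_b Gi a b * nab a b c) =
    (2 - m%:R) / 2 * (J *m th) c 0.
Proof.
move=> dOmE c.
have := dOm_contract c.
under eq_bigr do [under eq_bigr do [under eq_bigr do rewrite dOmE]; rewrite wedge_contract].
have -> : \sum_d J c d * ((2 - m%:R) * th d 0) = (2 - m%:R) * (J *m th) c 0.
  by rewrite mxE mulr_sumr; apply: eq_bigr => d _; ring.
move=> H; rewrite mulrAC H.
under eq_bigr do under eq_bigr do rewrite nabE mulrDr.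
under eq_bigr do rewrite big_split.
by rewrite big_split /= S1E S2E; field.
Qed.

End Algebra.

Lemma is_derive_mulmxr (g : 'rV[R]_m -> 'M[R]_m) (A : 'M[R]_m) x v i j :
  (forall i j, derivable (fun y => g y i j) x v) ->
  is_derive x v (fun y => (g y *m A) i j)
    (((\matrix_(i, j) 'D_v (fun y => g y i j) x) *m A) i j).
Proof.
move=> dg; rewrite mxE.
have -> : (fun y => (g y *m A) i j) = \sum_k (fun y => g y i k * A k j).
  by apply/funext => y; rewrite mxE fct_sumE.
apply: is_derive_sum => k; rewrite mxE.
have dA : is_derive x v (cst (A k j)) 0 by exact: is_derive_cst.
apply: is_derive_eq (is_deriveM (derivableP (dg i k)) dA) _.
by rewrite scaler0 add0r mulrC.
Qed.

Lemma pd_mulmxr (g : 'rV[R]_m -> 'M[R]_m) (A : 'M[R]_m) x a i j :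
  (forall i j, derivable (fun y => g y i j) x (delta_mx 0 a)) ->
  pd a (fun y => (g y *m A) i j) x =
  ((\matrix_(i, j) pd a (fun y => g y i j) x) *m A) i j.
Proof.
by move=> dg; rewrite (pd_val (is_derive_mulmxr A i j dg)).
Qed.

(** When [m = 2n + 2] the factor [(2 - m) / 2] is [- n], so this is the equation
    delta Omega = - n J theta. *)
Lemma codiff_lck (g : 'rV[R]_m -> 'M[R]_m) (J : 'M[R]_m)
    (th : 'rV[R]_m -> 'cV[R]_m) x :
  J *m J = - 1%:M ->
  (\forall y \near x, (g y)^T = g y) ->
  (\forall y \near x, J *m g y *m J^T = g y) ->
  (forall v : 'rV[R]_m, v != 0 -> 0 < (v *m g x *m v^T) 0 0) ->
  (forall a i j, derivable (fun y => g y i j) x (delta_mx 0 a)) ->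
  (forall a b c, d2 (fundamental_form g (cst J)) x a b c =
                 wedge12 th (fundamental_form g (cst J)) x a b c) ->
  codiff g (fundamental_form g (cst J)) x = ((2 - m%:R) / 2) *: (J *m th x).
Proof.
move=> JJ gs Jg gp dg dOm; have gsx := nbhs_singleton gs.
have [E EP] := orthonormal_basis_exists gsx gp.
have [gu EE] := orthonormal_basis_gram EP.
rewrite (codiffE _ EP); apply/colP => c; rewrite mxE [RHS]mxE.
pose Dg a : 'M[R]_m := \matrix_(i, j) pd a (fun y => g y i j) x.
have dOmE a b d : pd a (fun y => fundamental_form g (cst J) y b d) x =
    (Dg a *m J^T) b d by rewrite -pd_mulmxr.
have DgT a : (Dg a)^T = Dg a.
  apply/matrixP => i j; rewrite !mxE; apply: near_eq_derive.
  by apply: filterS gs => y gy; rewrite -[in LHS]gy mxE.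
have JTJT : J^T *m J^T = - 1%:M by rewrite -trmx_mul JJ linearN /= trmx1.
(* Differentiating [J g J^T = g]; equivalently [g J^T] stays antisymmetric. *)
have JDgJ a : J *m Dg a *m J^T = Dg a.
  suff -> : J *m Dg a = - (Dg a *m J^T).
    by rewrite mulNmx -mulmxA JTJT mulmxN mulmx1 opprK.
  rewrite -[J *m _]trmxK trmx_mul DgT; apply/matrixP => i j.
  rewrite [LHS]mxE [RHS]mxE -!pd_mulmxr// /pd -deriveN; last first.
    exact: (@ex_derive _ _ _ _ _ _ _ (is_derive_mulmxr J^T i j (dg a))).
  apply: near_eq_derive; apply: filterS2 gs Jg => y gy Jgy.
  rewrite -[in LHS]Jgy -!mulmxA JTJT !mulmxN mulmx1 mxE.
  by rewrite -[in LHS]gy -{1}(trmxK J) -trmx_mul mxE.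
have H := @divergence_contract J (g x) Dg (th x) gu gsx JJ (nbhs_singleton Jg).
rewrite -H.
- congr (- _); rewrite exchange_big /=; apply: eq_bigr => a _.
  rewrite exchange_big /=; apply: eq_bigr => b _.
  (* This turns the sum over the frame into a contraction with the inverse metric. *)
  have -> : invmx (g x) a b = \sum_k E k a * E k b.
    by rewrite -EE mxE; apply: eq_bigr => k _; rewrite mxE.
  rewrite mulr_suml; apply: eq_bigr => k _; congr (_ * _).
  rewrite /nabla2 dOmE; congr (_ - _ - _); apply: eq_bigr => d _; congr (_ * _).
    rewrite /christoffel; congr (_ * _); apply: eq_bigr => e _.
    by rewrite !mxE.
  rewrite /christoffel; congr (_ * _); apply: eq_bigr => e _.
  by rewrite !mxE.
- exact: DgT.
- exact: JDgJ.
- by move=> a b d; rewrite -!dOmE; exact: dOm.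
Qed.

End Codifferential.

(** * A Hermitian metric on the product of a punctured line and affine space *)

Section Model.
Context {R : realType} (n : nat).
Local Notation m := (2 * n + 2)%N.

Lemma complex_dim : (n.+1 + n.+1 = m)%N.
Proof. by rewrite mul2n -addnn addn2 addnS addSn. Qed.

(** [re k] and [im k] are the indices of the real and imaginary parts of p_k; the
    real parts come first. *)
Definition re (k : 'I_n.+1) : 'I_m := cast_ord complex_dim (lshift n.+1 k).
Definition im (k : 'I_n.+1) : 'I_m := cast_ord complex_dim (rshift n.+1 k).

Lemma re_eq k l : (re k == re l) = (k == l).
Proof. by rewrite /re (inj_eq (@cast_ord_inj _ _ _)) (inj_eq (@lshift_inj _ _)). Qed.

Lemma im_eq k l : (im k == im l) = (k == l).
Proof. by rewrite /im (inj_eq (@cast_ord_inj _ _ _)) (inj_eq (@rshift_inj _ _)). Qed.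

Lemma re_im k l : (re k == im l) = false.
Proof. by rewrite /re /im (inj_eq (@cast_ord_inj _ _ _)) eq_lrshift. Qed.

Lemma im_re k l : (im k == re l) = false.
Proof. by rewrite eq_sym re_im. Qed.

Lemma re_im_cover (a : 'I_m) : (exists k, a = re k) \/ (exists k, a = im k).
Proof.
have -> : a = cast_ord complex_dim (cast_ord (esym complex_dim) a).
  by rewrite cast_ordKV.
by case: (split_ordP (cast_ord (esym complex_dim) a)) => k ->; [left|right]; exists k.
Qed.

(** The coordinate 1-forms d(Re p_k) and d(Im p_k). *)
Definition dx k : 'cV[R]_m := delta_mx (re k) 0.
Definition dy k : 'cV[R]_m := delta_mx (im k) 0.

(** Multiplication by i on tangent vectors.  On the left of a column it is the
    transposed map, which sends d(Re p_k) to - d(Im p_k). *)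
Definition Jstd : 'M[R]_m := \sum_k (dx k *m (dy k)^T - dy k *m (dx k)^T).

Lemma Jstd_dx k : Jstd *m dx k = - dy k.
Proof.
rewrite /Jstd mulmx_suml (bigD1 k)//= big1 => [|l lk].
  rewrite addr0 mulmxBl -!mulmxA /dx /dy !trmx_delta !mul_delta_mx_cond.
  by rewrite im_re eqxx mulr0n mulr1n mulmx0 sub0r mul_delta_mx.
rewrite mulmxBl -!mulmxA /dx /dy !trmx_delta !mul_delta_mx_cond.
by rewrite im_re re_eq (negPf lk) !mulr0n !mulmx0 subr0.
Qed.

Lemma Jstd_dy k : Jstd *m dy k = dx k.
Proof.
rewrite /Jstd mulmx_suml (bigD1 k)//= big1 => [|l lk].
  rewrite addr0 mulmxBl -!mulmxA /dx /dy !trmx_delta !mul_delta_mx_cond.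
  by rewrite re_im eqxx mulr0n mulr1n mulmx0 subr0 mul_delta_mx.
rewrite mulmxBl -!mulmxA /dx /dy !trmx_delta !mul_delta_mx_cond.
by rewrite re_im im_eq (negPf lk) !mulr0n !mulmx0 subr0.
Qed.

Lemma Jstd_sqr : Jstd *m Jstd = - 1%:M.
Proof.
have ext (A B : 'M[R]_m) : (forall a, A *m (delta_mx a 0 : 'cV_m) = B *m delta_mx a 0) -> A = B.
  by move=> AB; apply/matrixP => i a; have /colP/(_ i) := AB a; rewrite -!colE !mxE.
apply: ext => a; rewrite -mulmxA mulNmx mul1mx.
by have [[k ->]|[k ->]] := re_im_cover a; rewrite -/(dx k) -/(dy k)
  ?Jstd_dx ?Jstd_dy ?mulmxN ?Jstd_dx ?Jstd_dy.
Qed.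

(** [alpha k] and [beta k] are the real and imaginary parts of
    phi_k = p_0 dp_k + (1 + i) p_k dp_0. *)
Definition alpha k (x : 'rV[R]_m) : 'cV[R]_m :=
  x 0 (re 0) *: dx k - x 0 (im 0) *: dy k
  + (x 0 (re k) - x 0 (im k)) *: dx 0 - (x 0 (re k) + x 0 (im k)) *: dy 0.

Definition beta k (x : 'rV[R]_m) : 'cV[R]_m :=
  x 0 (im 0) *: dx k + x 0 (re 0) *: dy k
  + (x 0 (re k) + x 0 (im k)) *: dx 0 + (x 0 (re k) - x 0 (im k)) *: dy 0.

Lemma Jstd_alpha k x : Jstd *m alpha k x = - beta k x.
Proof.
rewrite /alpha /beta !(mulmxDr, mulmxN) -!scalemxAr !(Jstd_dx, Jstd_dy).
by apply/colP => i; rewrite !mxE; ring.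
Qed.

Lemma Jstd_beta k x : Jstd *m beta k x = alpha k x.
Proof.
rewrite /alpha /beta !(mulmxDr, mulmxN) -!scalemxAr !(Jstd_dx, Jstd_dy).
by apply/colP => i; rewrite !mxE; ring.
Qed.

(** The real part of the Hermitian form sum_k phi_k (u) (conj phi_k (v)). *)
Definition lck_metric (x : 'rV[R]_m) : 'M[R]_m :=
  \sum_k (alpha k x *m (alpha k x)^T + beta k x *m (beta k x)^T).

Definition punctured : set 'rV[R]_m := [set x | x 0 (re 0) != 0 \/ x 0 (im 0) != 0].

(** |p_0|^2 *)
Definition modsq (x : 'rV[R]_m) : R := x 0 (re 0) ^+ 2 + x 0 (im 0) ^+ 2.

Lemma punctured_modsq x : punctured x <-> modsq x != 0.
Proof.
rewrite /punctured /modsq /= paddr_eq0 ?sqr_ge0// !expf_eq0 /= negb_and.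
by split=> [[->|->]|/orP]; rewrite ?orbT.
Qed.

Lemma lck_metric_sym x : (lck_metric x)^T = lck_metric x.
Proof.
rewrite /lck_metric linear_sum; apply: eq_bigr => k _.
by rewrite linearD /= !trmx_mul !trmxK.
Qed.

Lemma lck_metric_J x : Jstd *m lck_metric x *m Jstd^T = lck_metric x.
Proof.
rewrite /lck_metric mulmx_sumr mulmx_suml; apply: eq_bigr => k _.
rewrite mulmxDr mulmxDl !mulmxA Jstd_alpha Jstd_beta -!mulmxA -!trmx_mul.
by rewrite Jstd_alpha Jstd_beta linearN /= mulNmx mulmxN opprK addrC.
Qed.

Lemma dx_val (v : 'rV[R]_m) k : (v *m dx k) 0 0 = v 0 (re k).
Proof. by rewrite -colE mxE. Qed.

Lemma dy_val (v : 'rV[R]_m) k : (v *m dy k) 0 0 = v 0 (im k).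
Proof. by rewrite -colE mxE. Qed.

Lemma lck_metric_quad x (v : 'rV[R]_m) : (v *m lck_metric x *m v^T) 0 0 =
  \sum_k (((v *m alpha k x) 0 0) ^+ 2 + ((v *m beta k x) 0 0) ^+ 2).
Proof.
rewrite /lck_metric mulmx_sumr mulmx_suml summxE; apply: eq_bigr => k _.
rewrite mulmxDr mulmxDl !mulmxA -!(mulmxA (v *m _)) -!trmx_mul mxE.
by rewrite ![(_ *m _^T) 0 0]mxE !big_ord1 !expr2 !mxE.
Qed.

Lemma alpha_val k x (v : 'rV[R]_m) : (v *m alpha k x) 0 0 =
  x 0 (re 0) * v 0 (re k) - x 0 (im 0) * v 0 (im k)
  + (x 0 (re k) - x 0 (im k)) * v 0 (re 0) - (x 0 (re k) + x 0 (im k)) * v 0 (im 0).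
Proof.
by rewrite /alpha !(mulmxDr, mulmxN) -!scalemxAr !mxE -!(dx_val v) -!(dy_val v) !mxE.
Qed.

Lemma beta_val k x (v : 'rV[R]_m) : (v *m beta k x) 0 0 =
  x 0 (im 0) * v 0 (re k) + x 0 (re 0) * v 0 (im k)
  + (x 0 (re k) + x 0 (im k)) * v 0 (re 0) + (x 0 (re k) - x 0 (im k)) * v 0 (im 0).
Proof.
by rewrite /beta !(mulmxDr, mulmxN) -!scalemxAr !mxE -!(dx_val v) -!(dy_val v) !mxE.
Qed.

(** The complex equation (a + i b) (u + i v) = 0 in real terms. *)
Lemma rotation_eq0 (a b u v : R) :
  a ^+ 2 + b ^+ 2 != 0 -> a * u - b * v = 0 -> b * u + a * v = 0 -> u = 0 /\ v = 0.
Proof.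
move=> ab h1 h2; split; apply: (mulfI ab); rewrite mulr0.
  have -> : (a ^+ 2 + b ^+ 2) * u = a * (a * u - b * v) + b * (b * u + a * v) by ring.
  by rewrite h1 h2 !mulr0 addr0.
have -> : (a ^+ 2 + b ^+ 2) * v = a * (b * u + a * v) - b * (a * u - b * v) by ring.
by rewrite h1 h2 !mulr0 subr0.
Qed.

(** If phi_k (v) = 0 for all k, then phi_0 = (2 + i) p_0 dp_0 shows that the 0-th
    complex component of v vanishes, and then phi_k (v) = p_0 dp_k (v) shows it for
    the others. *)
Lemma lck_metric_pos x : punctured x ->
  forall v : 'rV[R]_m, v != 0 -> 0 < (v *m lck_metric x *m v^T) 0 0.
Proof.
move=> /punctured_modsq x0 v; rewrite lck_metric_quad lt0r; apply: contraNT.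
have q0 k : 0 <= ((v *m alpha k x) 0 0) ^+ 2 + ((v *m beta k x) 0 0) ^+ 2.
  by rewrite addr_ge0 ?sqr_ge0.
rewrite sumr_ge0 ?andbT ?negbK// psumr_eq0// => /allP vz.
have {vz} vz k : (v *m alpha k x) 0 0 = 0 /\ (v *m beta k x) 0 0 = 0.
  have := vz k (mem_index_enum _); rewrite /= paddr_eq0 ?sqr_ge0//.
  by rewrite !expf_eq0 /= => /andP[/eqP ? /eqP ?].
have [v0 w0] : v 0 (re 0) = 0 /\ v 0 (im 0) = 0.
  have [] := vz 0; rewrite alpha_val beta_val => h1 h2.
  (* [2 Re p_0 - Im p_0] and [2 Im p_0 + Re p_0] are the parts of (2 + i) p_0. *)
  apply: (@rotation_eq0 (2 * x 0 (re 0) - x 0 (im 0)) (2 * x 0 (im 0) + x 0 (re 0))).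
  - rewrite (_ : _ + _ = 5 * modsq x); last by rewrite /modsq; ring.
    by rewrite mulf_neq0 ?pnatr_eq0.
  - by rewrite -[RHS]h1; ring.
  - by rewrite -[RHS]h2; ring.
apply/eqP/rowP => a; rewrite mxE.
have vk k : v 0 (re k) = 0 /\ v 0 (im k) = 0.
  have [] := vz k; rewrite alpha_val beta_val v0 w0 !mulr0 !(subr0, addr0).
  exact: rotation_eq0.
by have [[k ->]|[k ->]] := re_im_cover a; have [] := vk k.
Qed.

End Model.

(** * The exterior derivative of the fundamental form *)

Section LinearForms.
Context {R : realType} {k : nat}.

(** This makes differentiating the linear functions [alpha k] and [beta k] a
    matter of differentiating coordinates. *)
Lemma linear_formE (f : 'rV[R]_k -> R) : linear f ->
  f = \sum_a (fun y : 'rV[R]_k => y 0 a * f (delta_mx 0 a)).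
Proof.
move=> lf; pose L := GRing.isLinear.Build R 'rV[R]_k R _ f lf.
pose F : {linear 'rV[R]_k -> R} := HB.pack f L.
apply/funext => y; rewrite fct_sumE -[LHS]/(F y) {1}[y]row_sum_delta linear_sum.
by apply: eq_bigr => a _; rewrite linearZ.
Qed.

Lemma is_derive_linear_form (f : 'rV[R]_k -> R) x v :
  linear f -> is_derive x v f (f v).
Proof.
move=> lf; have fE := linear_formE lf.
rewrite [in X in is_derive _ _ X]fE.
rewrite (_ : f v = \sum_a (v 0 a * f (delta_mx 0 a))); last by rewrite {1}fE fct_sumE.
apply: is_derive_sum => a.
have dA : is_derive x v (cst (f (delta_mx 0 a))) 0 by exact: is_derive_cst.
apply: is_derive_eq (is_deriveM (is_derive_coord a x v) dA) _.
by rewrite scaler0 add0r mulrC.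
Qed.

Lemma Cn_linear_form N U (f : 'rV[R]_k -> R) : open U -> linear f -> Cn N U f.
Proof.
move=> oU lf; apply: Cn_eq (oU) _ (Cn_sum (f := fun a y => y 0 a * f (delta_mx 0 a)) oU _).
  by move=> x _; rewrite [in RHS](linear_formE lf) fct_sumE.
move=> a; apply: CnM => //; first exact: Cn_coord.
exact: (Cn_cst N (f (delta_mx 0 a))).
Qed.

End LinearForms.

Section ModelCalculus.
Context {R : realType} (n : nat).
Local Notation m := (2 * n + 2)%N.
Local Notation re := (@re n).
Local Notation im := (@im n).
Local Notation dx := (@dx R n).
Local Notation dy := (@dy R n).
Implicit Types x y : 'rV[R]_m.

Lemma alpha_linear k c : linear (fun y : 'rV[R]_m => alpha k y c 0).
Proof. by move=> l u v; rewrite /alpha /= !mxE /GRing.scale /=; ring. Qed.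

Lemma beta_linear k c : linear (fun y : 'rV[R]_m => beta k y c 0).
Proof. by move=> l u v; rewrite /beta /= !mxE /GRing.scale /=; ring. Qed.

Lemma outer_productE (p : nat) (u w : 'cV[R]_p) a b : (u *m w^T) a b = u a 0 * w b 0.
Proof. by rewrite mxE big_ord1 mxE. Qed.

Lemma lck_metricE y a b : lck_metric y a b =
  \sum_k (alpha k y a 0 * alpha k y b 0 + beta k y a 0 * beta k y b 0).
Proof.
rewrite /lck_metric summxE; apply: eq_bigr => k _.
by rewrite mxE !outer_productE.
Qed.

Lemma lck_metric_smooth N U : open U -> Cn N U (@lck_metric R n).
Proof.
move=> oU; apply: Cn_mx => // a b.
apply: Cn_eq (oU) (fun x _ => esym (lck_metricE x a b)) _.
pose f k (y : 'rV[R]_m) := alpha k y a 0 * alpha k y b 0 + beta k y a 0 * beta k y b 0.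
apply: (@Cn_sum _ _ _ _ _ _ f) => // k; rewrite /f.
have Ca c : Cn N U (fun y => alpha k y c 0) by apply: Cn_linear_form => //; exact: alpha_linear.
have Cb c : Cn N U (fun y => beta k y c 0) by apply: Cn_linear_form => //; exact: beta_linear.
exact: (CnD oU (CnM oU (Ca a) (Ca b)) (CnM oU (Cb a) (Cb b))).
Qed.

(** Omega = sum_k beta_k /\ alpha_k *)
Lemma lck_formE (y : 'rV[R]_m) a b : fundamental_form (@lck_metric R n) (cst (Jstd n)) y a b =
  \sum_k (beta k y a 0 * alpha k y b 0 - alpha k y a 0 * beta k y b 0).
Proof.
rewrite /fundamental_form /lck_metric /= mulmx_suml summxE; apply: eq_bigr => k _.
rewrite mulmxDl -!mulmxA -!trmx_mul Jstd_alpha Jstd_beta linearN /= mulmxN addrC.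
by rewrite mxE [X in _ + X]mxE !outer_productE.
Qed.

Lemma is_derive_prod (f g : 'rV[R]_m -> R) x v : linear f -> linear g ->
  is_derive x v (fun y => f y * g y) (f v * g x + f x * g v).
Proof.
move=> lf lg.
have df := is_derive_linear_form x v lf; have dg := is_derive_linear_form x v lg.
by apply: is_derive_eq (is_deriveM df dg) _; rewrite addrC /GRing.scale /= (mulrC (g x)).
Qed.

Lemma is_derive_lck_form x v a b :
  is_derive x v (fun y => fundamental_form (@lck_metric R n) (cst (Jstd n)) y a b)
    (\sum_k (beta k v a 0 * alpha k x b 0 + beta k x a 0 * alpha k v b 0
       - (alpha k v a 0 * beta k x b 0 + alpha k x a 0 * beta k v b 0))).
Proof.
have -> : (fun y => fundamental_form (@lck_metric R n) (cst (Jstd n)) y a b) =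
    \sum_k ((fun y => beta k y a 0 * alpha k y b 0) - (fun y => alpha k y a 0 * beta k y b 0)).
  by apply/funext => y; rewrite lck_formE fct_sumE.
have H k := is_deriveB
  (is_derive_prod x v (@beta_linear k a) (@alpha_linear k b))
  (is_derive_prod x v (@alpha_linear k a) (@beta_linear k b)).
exact: (is_derive_sum H).
Qed.

Lemma lck_metric_derivable x a b v : derivable (fun y => lck_metric y a b) x v.
Proof.
have -> : (fun y : 'rV[R]_m => lck_metric y a b) =
    \sum_k ((fun y => alpha k y a 0 * alpha k y b 0) + (fun y => beta k y a 0 * beta k y b 0)).
  by apply/funext => y; rewrite lck_metricE fct_sumE.
have H k := is_deriveD
  (is_derive_prod x v (@alpha_linear k a) (@alpha_linear k b))
  (is_derive_prod x v (@beta_linear k a) (@beta_linear k b)).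
exact: (@ex_derive _ _ _ _ _ _ _ (is_derive_sum H)).
Qed.

(** theta = 2 d(arg p_0) *)
Definition theta x : 'cV[R]_m :=
  (2 / modsq x) *: (x 0 (re 0) *: dy 0 - x 0 (im 0) *: dx 0).

Lemma delta_dx (a : 'I_m) k : (delta_mx 0 a : 'rV[R]_m) 0 (re k) = dx k a 0.
Proof. by rewrite !mxE eqxx andbT eq_sym. Qed.

Lemma delta_dy (a : 'I_m) k : (delta_mx 0 a : 'rV[R]_m) 0 (im k) = dy k a 0.
Proof. by rewrite !mxE eqxx andbT eq_sym. Qed.

Lemma alphaE k x c : alpha k x c 0 =
  x 0 (re 0) * dx k c 0 - x 0 (im 0) * dy k c 0
  + (x 0 (re k) - x 0 (im k)) * dx 0 c 0 - (x 0 (re k) + x 0 (im k)) * dy 0 c 0.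
Proof. by rewrite /alpha; move: (dx _) (dy _) (dx _) (dy _) => r i r0 i0; rewrite !mxE. Qed.

Lemma betaE k x c : beta k x c 0 =
  x 0 (im 0) * dx k c 0 + x 0 (re 0) * dy k c 0
  + (x 0 (re k) + x 0 (im k)) * dx 0 c 0 + (x 0 (re k) - x 0 (im k)) * dy 0 c 0.
Proof. by rewrite /beta; move: (dx _) (dy _) (dx _) (dy _) => r i r0 i0; rewrite !mxE. Qed.

Lemma alpha_deltaE k a c : alpha k (delta_mx 0 a) c 0 =
  dx 0 a 0 * dx k c 0 - dy 0 a 0 * dy k c 0
  + (dx k a 0 - dy k a 0) * dx 0 c 0 - (dx k a 0 + dy k a 0) * dy 0 c 0.
Proof. by rewrite alphaE !delta_dx !delta_dy. Qed.

Lemma beta_deltaE k a c : beta k (delta_mx 0 a) c 0 =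
  dy 0 a 0 * dx k c 0 + dx 0 a 0 * dy k c 0
  + (dx k a 0 + dy k a 0) * dx 0 c 0 + (dx k a 0 - dy k a 0) * dy 0 c 0.
Proof. by rewrite betaE !delta_dx !delta_dy. Qed.

Lemma thetaE x c : theta x c 0 =
  2 / modsq x * (x 0 (re 0) * dy 0 c 0 - x 0 (im 0) * dx 0 c 0).
Proof. by rewrite /theta; move: (dx _) (dy _) => r i; rewrite !mxE. Qed.

(** The contribution of one index [k] to dOmega = theta /\ Omega, as an identity of
    rational functions.  It expresses d phi_k = - i d(log p_0) /\ phi_k, which
    holds because phi_k is p_0^(-i) times an exact form.  Here p_0 = p + i q,
    p_k = u + i v, and [A a], [B a] are [alpha k], [beta k] at the [a]-th basis
    vector; as these are linear in the point, they are also its partial derivatives. *)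
Lemma structure_equation (T : Type) (p q u v : R) (r0 i0 r i : T -> R)
    (A B : T -> T -> R) (Ax Bx th : T -> R) :
  (forall a c, A a c = r0 a * r c - i0 a * i c + (r a - i a) * r0 c - (r a + i a) * i0 c) ->
  (forall a c, B a c = i0 a * r c + r0 a * i c + (r a + i a) * r0 c + (r a - i a) * i0 c) ->
  (forall c, Ax c = p * r c - q * i c + (u - v) * r0 c - (u + v) * i0 c) ->
  (forall c, Bx c = q * r c + p * i c + (u + v) * r0 c + (u - v) * i0 c) ->
  (forall c, th c = 2 / (p ^+ 2 + q ^+ 2) * (p * i0 c - q * r0 c)) ->
  p ^+ 2 + q ^+ 2 != 0 -> forall a b c,
  B a b * Ax c + Bx b * A a c - (A a b * Bx c + Ax b * B a c) +
  (B b c * Ax a + Bx c * A b a - (A b c * Bx a + Ax c * B b a)) +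
  (B c a * Ax b + Bx a * A c b - (A c a * Bx b + Ax a * B c b)) =
  th a * (Bx b * Ax c - Ax b * Bx c) + th b * (Bx c * Ax a - Ax c * Bx a) +
  th c * (Bx a * Ax b - Ax a * Bx b).
Proof.
move=> hA hB hAx hBx hth pq a b c; rewrite !(hA, hB, hAx, hBx, hth).
by field.
Qed.

Lemma lck_form_d2 x a b c : punctured x ->
  d2 (fundamental_form (@lck_metric R n) (cst (Jstd n))) x a b c =
  wedge12 theta (fundamental_form (@lck_metric R n) (cst (Jstd n))) x a b c.
Proof.
move=> /punctured_modsq; rewrite /modsq => x0.
rewrite /d2 /wedge12 !(pd_val (is_derive_lck_form _ _ _ _)) !lck_formE.
rewrite !mulr_sumr -!big_split; apply: eq_bigr => k _ /=.
exact: (structure_equation (A := fun a c => alpha k (delta_mx 0 a) c 0)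
  (B := fun a c => beta k (delta_mx 0 a) c 0) (Ax := fun c => alpha k x c 0)
  (Bx := fun c => beta k x c 0) (th := fun c => theta x c 0)
  (@alpha_deltaE k) (@beta_deltaE k) (alphaE k x) (betaE k x) (thetaE x) x0).
Qed.

End ModelCalculus.

(** * The angular form and its transform by the complex structure *)

Section LeeForm.
Context {R : realType} (n : nat).
Local Notation m := (2 * n + 2)%N.
Local Notation re := (@re n).
Local Notation im := (@im n).
Local Notation dx := (@dx R n).
Local Notation dy := (@dy R n).
Implicit Types x y v : 'rV[R]_m.

Lemma is_derive_modsq x v : is_derive x v (@modsq R n)
  (2 * (x 0 (re 0) * v 0 (re 0) + x 0 (im 0) * v 0 (im 0))).
Proof.
have dr := is_derive_coord (re 0) x v; have di := is_derive_coord (im 0) x v.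
have -> : @modsq R n = (fun y => y 0 (re 0) * y 0 (re 0)) + (fun y => y 0 (im 0) * y 0 (im 0)).
  by apply/funext => y; rewrite /modsq !expr2.
apply: is_derive_eq (is_deriveD (is_deriveM dr dr) (is_deriveM di di)) _.
by rewrite /GRing.scale /=; ring.
Qed.

Lemma is_derive_theta x v c : modsq x != 0 ->
  is_derive x v (fun y => theta y c 0)
   (2 / modsq x * (v 0 (re 0) * dy 0 c 0 - v 0 (im 0) * dx 0 c 0) -
    4 / modsq x ^+ 2 * (x 0 (re 0) * v 0 (re 0) + x 0 (im 0) * v 0 (im 0)) *
      (x 0 (re 0) * dy 0 c 0 - x 0 (im 0) * dx 0 c 0)).
Proof.
move=> x0; pose l y : R := y 0 (re 0) * dy 0 c 0 - y 0 (im 0) * dx 0 c 0.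
have lin : linear l.
  rewrite /l; move: (dy _) (dx _) => i r k u w.
  by rewrite !mxE /GRing.scale /=; ring.
have dl := is_derive_linear_form x v lin.
have dmodsq := is_derive_modsq x v.
have dV : is_derive x v (fun y => (modsq y)^-1)
    (- modsq x ^- 2 *: (2 * (x 0 (re 0) * v 0 (re 0) + x 0 (im 0) * v 0 (im 0)))).
  apply: DeriveDef; first exact: derivableV.
  by rewrite deriveV// derive_val.
have -> : (fun y => theta y c 0) = (fun y => 2 * ((modsq y)^-1 * l y)).
  by apply/funext => y; rewrite thetaE mulrA.
have d2 : is_derive x v (cst (2 : R)) 0 by exact: is_derive_cst.
apply: is_derive_eq (is_deriveM d2 (is_deriveM dV dl)) _.
rewrite /= scaler0 addr0 /l /GRing.scale /=.
move: (dy _ _ _) (dx _ _ _) (modsq x) x0 => i r q q0.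
by field.
Qed.

Lemma theta_closed x a b : punctured x -> d1 (@theta R n) x a b = 0.
Proof.
move=> /punctured_modsq x0.
rewrite /d1 !(pd_val (is_derive_theta _ _ x0)).
rewrite !delta_dx !delta_dy; move: x0; rewrite /modsq.
move: (x 0 (re 0)) (x 0 (im 0)) (dx 0 a 0) (dy 0 a 0) (dx 0 b 0) (dy 0 b 0).
by move=> p q ra ia rb ib pq; field.
Qed.

Lemma theta_neq0 x : punctured x -> theta x != 0.
Proof.
move=> Ux; have /punctured_modsq x0 := Ux; apply/eqP => th0.
have t0 : 2 / modsq x != 0 by rewrite mulf_neq0 ?invr_eq0 ?pnatr_eq0.
have := thetaE x (im 0); have := thetaE x (re 0); rewrite th0 /dx /dy !mxE.
rewrite !eqxx re_im im_re /= !mulr0 !mulr1 sub0r subr0.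
move=> /esym/eqP; rewrite mulf_eq0 (negPf t0) oppr_eq0 => /eqP xi.
move=> /esym/eqP; rewrite mulf_eq0 (negPf t0) => /eqP xr.
by case: Ux; rewrite ?xi ?xr eqxx.
Qed.

Lemma punctured_open : open (@punctured R n).
Proof.
have -> : @punctured R n = (fun y => y 0 (re 0)) @^-1` [set r | r != 0] `|`
    (fun y => y 0 (im 0)) @^-1` [set r | r != 0].
  by apply/seteqP; split.
have o0 : open [set r : R | r != 0] by exact: open_neq.
apply: openU; apply: open_comp => // y _; exact: coord_continuous.
Qed.

(** J theta = 2 d(log |p_0|) *)
Lemma Jstd_theta x : Jstd n *m theta x =
  (2 / modsq x) *: (x 0 (re 0) *: dx 0 + x 0 (im 0) *: dy 0).
Proof.
rewrite /theta -scalemxAr mulmxBr -!scalemxAr Jstd_dy Jstd_dx scalerN opprK.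
by [].
Qed.

End LeeForm.

(** * Integral manifolds swept by rotating one coordinate plane *)

Section CircleLeaf.
Context {R : realType} {k : nat}.
Variables (j : 'I_k.+1) (i : 'I_k) (x : 'rV[R]_k.+1).
Local Notation li := (lift j i).

Definition trig (c d : R) (y : 'rV[R]_k) : R := c * cos (y 0 i) + d * sin (y 0 i).

Definition leaf_coord (a : 'I_k.+1) : 'rV[R]_k -> R :=
  if unlift j a is Some a' then
    if a' == i then trig (x 0 li) (- x 0 j) else fun y => x 0 a + y 0 a'
  else trig (x 0 j) (x 0 li).

(** Starting at [x], the coordinates [lift j i] and [j] are rotated by the angle
    [y 0 i] and the others are translated. *)
Definition leaf (y : 'rV[R]_k) : 'rV[R]_k.+1 := \row_a leaf_coord a y.

Definition dleaf (y v : 'rV[R]_k) : 'rV[R]_k.+1 := \row_a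
  if unlift j a is Some a' then
    if a' == i then - (leaf y 0 j * v 0 i) else v 0 a'
  else leaf y 0 li * v 0 i.

Lemma leaf_j y : leaf y 0 j = trig (x 0 j) (x 0 li) y.
Proof. by rewrite mxE /leaf_coord unlift_none. Qed.

Lemma leaf_li y : leaf y 0 li = trig (x 0 li) (- x 0 j) y.
Proof. by rewrite mxE /leaf_coord liftK eqxx. Qed.

Lemma dleaf_j y v : dleaf y v 0 j = leaf y 0 li * v 0 i.
Proof. by rewrite [LHS]mxE unlift_none. Qed.

Lemma dleaf_li y v : dleaf y v 0 li = - (leaf y 0 j * v 0 i).
Proof. by rewrite [LHS]mxE liftK eqxx. Qed.

Lemma leaf0 : leaf 0 = x.
Proof.
apply/rowP => a; rewrite mxE /leaf_coord /trig.
case: unliftP => [a' ->|->]; last by rewrite mxE cos0 sin0 mulr1 mulr0 addr0.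
case: eqP => [->|_]; rewrite mxE ?addr0//.
by rewrite cos0 sin0 mulr1 mulr0 addr0.
Qed.

Lemma leaf_radius y :
  leaf y 0 li ^+ 2 + leaf y 0 j ^+ 2 = x 0 li ^+ 2 + x 0 j ^+ 2.
Proof.
rewrite leaf_j leaf_li /trig -[RHS]mulr1 -(cos2Dsin2 (y 0 i)).
by ring.
Qed.

Lemma trig_smooth c d N : Cn N setT (trig c d).
Proof.
have oT := @openT 'rV[R]_k; have [cc cs] := @Cn_cos_sin R k N i.
exact: (CnD oT (CnM oT (Cn_cst N c oT) cc) (CnM oT (Cn_cst N d oT) cs)).
Qed.

Lemma leaf_smooth : smooth setT leaf.
Proof.
have oT := @openT 'rV[R]_k.
move=> N; apply: Cn_mx => // b a.
apply: (Cn_eq (f := leaf_coord a)) => //; first by move=> y _; rewrite mxE.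
rewrite /leaf_coord; case: unliftP => [a' _|_]; last exact: trig_smooth.
case: eqP => _; first exact: trig_smooth.
exact: (CnD oT (Cn_cst N (x 0 a) oT) (Cn_coord N a' oT)).
Qed.

Lemma trig_differentiable c d y : differentiable (trig c d) y.
Proof.
have dc : differentiable (fun y : 'rV[R]_k => y 0 i : R) y.
  exact: differentiable_coord.
have dcos : differentiable (fun y : 'rV[R]_k => cos (y 0 i)) y.
  apply: (@differentiable_comp _ _ _ _ (fun y : 'rV[R]_k => y 0 i : R) cos) => //.
  by apply/derivable1_diffP.
have dsin : differentiable (fun y : 'rV[R]_k => sin (y 0 i)) y.
  apply: (@differentiable_comp _ _ _ _ (fun y : 'rV[R]_k => y 0 i : R) sin) => //.
  by apply/derivable1_diffP.
have dcst (r : R) : differentiable (cst r : 'rV[R]_k -> R) y by exact: differentiable_cst.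
exact: (differentiableD (differentiableM (dcst c) dcos) (differentiableM (dcst d) dsin)).
Qed.

Lemma leaf_differentiable y : differentiable leaf y.
Proof.
have -> : leaf = \sum_a (fun y => leaf_coord a y *: (delta_mx 0 a : 'rV[R]_k.+1)).
  apply/funext => z; rewrite fct_sumE [LHS]row_sum_delta.
  by apply: eq_bigr => a _; rewrite mxE.
apply: differentiable_sum => a; apply: differentiableZl.
rewrite /leaf_coord; case: unliftP => [a' _|_]; last exact: trig_differentiable.
case: eqP => _; first exact: trig_differentiable.
apply: differentiableD; first exact: differentiable_cst.
exact: differentiable_coord.
Qed.

Lemma is_derive_trig c d (y v : 'rV[R]_k) : is_derive y v (trig c d)
  (trig d (- c) y * v 0 i).
Proof.
have dcst (r : R) : is_derive y v (cst r) 0 by exact: is_derive_cst.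
have dc := is_derive_comp1 v (is_derive_cos (y 0 i)).
have ds := is_derive_comp1 v (is_derive_sin (y 0 i)).
apply: is_derive_eq (is_deriveD (is_deriveM (dcst c) dc) (is_deriveM (dcst d) ds)) _.
by rewrite /trig /GRing.scale /=; ring.
Qed.

Lemma diff_leaf y : 'd leaf y = dleaf y :> ('rV[R]_k -> 'rV[R]_k.+1).
Proof.
apply/funext => v; have dl := leaf_differentiable y.
rewrite -deriveE// derive_mx; last exact: diff_derivable.
apply/rowP => a; rewrite [LHS]mxE [RHS]mxE.
have -> : (fun t => leaf t 0 a) = leaf_coord a by apply/funext => t; rewrite mxE.
rewrite leaf_j leaf_li /leaf_coord; case: unliftP => [a' _|_].
  case: eqP => [_|_].
    rewrite (@derive_val _ _ _ _ _ _ _ (is_derive_trig _ _ y v)) /trig; ring.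
  have dcst (r : R) : is_derive y v (cst r) 0 by exact: is_derive_cst.
  have H := is_deriveD (dcst (x 0 a)) (is_derive_coord a' y v).
  by rewrite (@derive_val _ _ _ _ _ _ _ H) add0r.
by rewrite (@derive_val _ _ _ _ _ _ _ (is_derive_trig _ _ y v)) /trig.
Qed.

Hypothesis x0 : x 0 li ^+ 2 + x 0 j ^+ 2 != 0.

Lemma dleaf_inj y : injective (dleaf y).
Proof.
move=> v w vw; have E a : dleaf y v 0 a = dleaf y w 0 a by rewrite vw.
have vwi : v 0 i = w 0 i.
  have := E j; have := E li; rewrite !dleaf_j !dleaf_li.
  move=> /oppr_inj e1 e2; apply: (mulfI x0); rewrite -(leaf_radius y) !mulrDl.
  by rewrite !expr2 -!mulrA e1 e2.
apply/rowP => a; have := E (lift j a); rewrite !mxE liftK.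
by case: eqP => [->|].
Qed.

Lemma range_dleaf y : range (dleaf y) =
  [set w : 'rV[R]_k.+1 | leaf y 0 li * w 0 li + leaf y 0 j * w 0 j = 0].
Proof.
apply/seteqP; split=> [_ [v _ <-]|w /= w0].
  by rewrite /= dleaf_j dleaf_li; ring.
pose t := (leaf y 0 li * w 0 j - leaf y 0 j * w 0 li) / (x 0 li ^+ 2 + x 0 j ^+ 2).
pose v : 'rV[R]_k := \row_a if a == i then t else w 0 (lift j a).
have vi : v 0 i = t by rewrite mxE eqxx.
exists v => //.
have r0 := x0; rewrite -(leaf_radius y) in r0.
apply/rowP => a; rewrite [LHS]mxE; case: unliftP => [a' ->|->].
  case: eqP => [->|/eqP ai]; last by rewrite mxE (negPf ai).
  rewrite vi /t -(leaf_radius y); apply: (mulfI r0).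
  move: (leaf y 0 li) (leaf y 0 j) (w 0 li) (w 0 j) w0 r0 => p q r s pq r0.
  transitivity (q * q * r - p * (q * s)); first by field.
  have -> : q * s = - (p * r) by apply/eqP; rewrite -addr_eq0 addrC pq.
  by ring.
rewrite vi /t -(leaf_radius y); apply: (mulfI r0).
move: (leaf y 0 li) (leaf y 0 j) (w 0 li) (w 0 j) w0 r0 => p q r s pq r0.
transitivity (p * p * s - q * (p * r)); first by field.
have -> : p * r = - (q * s) by apply/eqP; rewrite -addr_eq0 pq.
by ring.
Qed.

End CircleLeaf.

(** If [th] is a nonzero multiple of the radial form y_i dy_i + y_j dy_j of a
    coordinate plane, its kernel is tangent to the cylinder over a circle, which
    [leaf] parametrizes.  The dimension is given by an equation because 2 n + 2 is
    not a successor by conversion. *)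
Lemma circle_integral_manifold (R : realType) (k M : nat) (i j : 'I_M)
    (U : set 'rV[R]_M) (th : 'rV[R]_M -> 'cV[R]_M) (x : 'rV[R]_M) :
  M = k.+1 -> i != j -> x 0 i ^+ 2 + x 0 j ^+ 2 != 0 ->
  (forall y : 'rV[R]_M, y 0 i ^+ 2 + y 0 j ^+ 2 = x 0 i ^+ 2 + x 0 j ^+ 2 ->
     U y /\ exists2 c, c != 0 & th y = c *: (y 0 i *: delta_mx i 0 + y 0 j *: delta_mx j 0)) ->
  integral_manifold_at k U th x.
Proof.
move=> Mk; move: i j U th x; rewrite {}Mk => i j U th x.
rewrite eq_sym; case: (unliftP j i) => [i' ->|->]; last by rewrite eqxx.
move=> _ x0 Uth; exists setT, (leaf j i' x); split=> //.
- exact: openT.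
- exact: leaf_smooth.
- exact: leaf0.
move=> y _; have [Uy [c c0 thy]] := Uth _ (leaf_radius j i' x y).
rewrite diff_leaf; split=> //; first exact: dleaf_inj.
have pair (p q : R) (w : 'rV[R]_k.+1) :
    w *m (c *: (p *: delta_mx (lift j i') 0 + q *: delta_mx j 0)) =
    (c * (p * w 0 (lift j i') + q * w 0 j))%:M.
  by rewrite -scalemxAr mulmxDr -!scalemxAr -!colE [LHS]mx11_scalar !mxE.
rewrite range_dleaf//; apply/seteqP; split=> w /= wE; move: wE; rewrite thy pair.
  by move=> ->; rewrite mulr0 raddf0.
by move=> /matrixP/(_ 0 0); rewrite !mxE mulr1n => /eqP; rewrite mulf_eq0 (negPf c0) => /eqP.
Qed.

(** * The angular form has no primitive *)

Section NotExact.
Context {R : realType}.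

Lemma is_derive_line (V : normedModType R) (F : V -> R) (x v : V) (t : R) :
  derivable F (x + t *: v) v ->
  is_derive t 1 (fun s => F (x + s *: v)) ('D_v F (x + t *: v)).
Proof.
have E : (fun h : R => h^-1 *: (((fun s => F (x + s *: v)) \o shift t) (h *: 1) - F (x + t *: v))) =
    (fun h => h^-1 *: ((F \o shift (x + t *: v)) (h *: v) - F (x + t *: v))).
  apply/funext => h /=; congr (_ *: (F _ - _)).
  by rewrite [h *: 1]mulr1 scalerDl addrCA.
by move=> dF; apply: DeriveDef; rewrite /derivable /derive E.
Qed.

(** Moving along a coordinate axis only involves a directional derivative, so the
    mean value theorem applies without the chain rule in several variables. *)
Lemma segment_mvt (V : normedModType R) (F : V -> R) (x v : V) (L : R) : 0 < L ->
  (forall t, derivable F (x + t *: v) v) ->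
  exists c, F (x + L *: v) - F x = 'D_v F (x + c *: v) * L.
Proof.
move=> L0 dF.
have [||c _ cE] := @MVT R (fun s => F (x + s *: v)) (fun t => 'D_v F (x + t *: v)) 0 L L0.
- by move=> t _; exact: is_derive_line.
- apply: derivable_within_continuous => t _.
  exact: (@ex_derive _ _ _ _ _ _ _ (is_derive_line (dF t))).
by exists c; rewrite -[L in RHS]subr0 -cE scale0r addr0.
Qed.

Variable n : nat.
Local Notation m := (2 * n + 2)%N.
Local Notation re := (@re n).
Local Notation im := (@im n).
Local Notation er := (delta_mx 0 (re 0) : 'rV[R]_m).
Local Notation ei := (delta_mx 0 (im 0) : 'rV[R]_m).

Lemma plane_point (p q : R) :
  (p *: er + q *: ei) 0 (re 0) = p /\ (p *: er + q *: ei) 0 (im 0) = q.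
Proof. by rewrite !mxE !eqxx re_im im_re /= !mulr0 !mulr1 addr0 add0r. Qed.

Lemma theta_plane (p q : R) : let x := p *: er + q *: ei in
  theta x (re 0) 0 = - (2 * q) / (p ^+ 2 + q ^+ 2) /\
  theta x (im 0) 0 = 2 * p / (p ^+ 2 + q ^+ 2).
Proof.
move=> x; have [xr xi] := plane_point p q.
rewrite !thetaE /modsq xr xi /dx /dy !mxE !eqxx re_im im_re /=.
by rewrite !mulr0 !mulr1 sub0r subr0; split; ring.
Qed.

(** The square with corners p_0 = (+/-1, +/-1) has sides parallel to the axes, and
    theta is positive on each of them, run counterclockwise.  A primitive would
    increase along all four sides and return to its value. *)
Lemma theta_not_exact (F : 'rV[R]_m -> R) : smooth (@punctured R n) F ->
  ~ (forall x, punctured x -> forall a, theta x a 0 = pd a F x).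
Proof.
move=> /(_ 1%N)[_ sF] dF.
pose P p q : 'rV[R]_m := p *: er + q *: ei.
have Pp p q : p != 0 -> punctured (P p q).
  by move=> p0; left; rewrite (plane_point p q).1.
have Pq p q : q != 0 -> punctured (P p q).
  by move=> q0; right; rewrite (plane_point p q).2.
have Pei p q t : P p q + t *: ei = P p (q + t) by rewrite /P scalerDl addrA.
have Per p q t : P p q + t *: er = P (p + t) q by rewrite /P scalerDl addrAC.
have two : -1 + 2 = 1 :> R by ring.
(* The sign of the increment along a vertical side is that of its abscissa [p];
   along a horizontal side it is opposite to that of its ordinate [q]. *)
have vert p : p != 0 -> exists2 c, 0 < c & F (P p 1) - F (P p (-1)) = p * c.
  move=> p0; have [|t] := @segment_mvt _ F (P p (-1)) ei 2 (ltr0n R 2).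
    by move=> t; rewrite Pei; apply: (sF (im 0)).1; exact: Pp.
  rewrite Pei two Pei -[X in _ = X * _](dF _ (Pp _ _ p0)) (theta_plane _ _).2 => ->.
  exists (4 / (p ^+ 2 + (-1 + t) ^+ 2)); last by ring.
  by rewrite divr_gt0// ltr_pwDl ?sqr_ge0// exprn_even_gt0.
have horiz q : q != 0 -> exists2 c, 0 < c & F (P 1 q) - F (P (-1) q) = - (q * c).
  move=> q0; have [|t] := @segment_mvt _ F (P (-1) q) er 2 (ltr0n R 2).
    by move=> t; rewrite Per; apply: (sF (re 0)).1; exact: Pq.
  rewrite Per two Per -[X in _ = X * _](dF _ (Pq _ _ q0)) (theta_plane _ _).1 => ->.
  exists (4 / ((-1 + t) ^+ 2 + q ^+ 2)); last by ring.
  by rewrite divr_gt0// ltr_wpDl ?sqr_ge0// exprn_even_gt0.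
have N1 : -1 != 0 :> R by rewrite oppr_eq0 oner_eq0.
have [c1 c1_gt0 e1] := vert 1 (oner_neq0 _).
have [c2 c2_gt0 e2] := vert (-1) N1.
have [c3 c3_gt0 e3] := horiz 1 (oner_neq0 _).
have [c4 c4_gt0 e4] := horiz (-1) N1.
by move: e1 e2 e3 e4; lra.
Qed.

End NotExact.

(** * The example *)

Section Example.
Context {R : realType} (n : nat).
Local Notation m := (2 * n + 2)%N.
Local Notation re := (@re n).
Local Notation im := (@im n).
Local Notation U := (@punctured R n).

Lemma base_point : U (delta_mx 0 (re 0)).
Proof. by left; rewrite mxE !eqxx oner_neq0. Qed.

Definition punctured_space : smooth_manifold R m :=
  open_submanifold (@punctured_open R n) base_point.
Local Notation M := punctured_space.

Lemma atlas_cod (c : chart R m M) : atlas M c -> cod c = U.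
Proof. by move=> ->; exact: sub_cod. Qed.

Lemma atlas_overlap (c c' : chart R m M) x : atlas M c -> atlas M c' ->
  overlap c c' x ->
  [/\ U x, transition c c' x = x & 'J (transition c c') x = 1%:M].
Proof.
move=> -> ->; rewrite sub_overlap => Ux; split=> //.
  exact: sub_transitionE.
exact: (sub_jacobian (@punctured_open R n)).
Qed.

Program Definition J_field : endomorphism_field M :=
  @EndomorphismField R m M (fun _ => cst (Jstd n)) _ _.
Next Obligation.
by move=> c cM N; rewrite atlas_cod//; apply: Cn_cst; exact: punctured_open.
Qed.
Next Obligation.
by move=> c c' cM c'M x /(atlas_overlap cM c'M)[_ _ ->]; rewrite mulmx1 mul1mx.
Qed.

Program Definition g_field : riemannian_metric M :=
  @RiemannianMetric R m M (fun _ => @lck_metric R n) _ _ _ _.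
Next Obligation.
by move=> c cM N; rewrite atlas_cod//; apply: lck_metric_smooth; exact: punctured_open.
Qed.
Next Obligation.
move=> c c' cM c'M x /(atlas_overlap cM c'M)[_ -> ->].
by rewrite mul1mx trmx1 mulmx1.
Qed.
Next Obligation. by move=> c cM x _; exact: lck_metric_sym. Qed.
Next Obligation. by move=> c cM x; rewrite atlas_cod// => Ux v; exact: lck_metric_pos. Qed.

Hypothesis n_gt0 : (1 <= n)%N.

Lemma anti_lee_formE (c : chart R m M) x : U x ->
  anti_lee_form J_field g_field c x = - (Jstd n *m theta x).
Proof.
move=> Ux; rewrite /anti_lee_form.
rewrite -[codiff _ _ _]/(codiff (@lck_metric R n)
  (fundamental_form (@lck_metric R n) (cst (Jstd n))) x).
rewrite (@codiff_lck _ _ _ _ (@theta R n)).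
- have n0 : n%:R != 0 :> R by rewrite pnatr_eq0 -lt0n.
  have -> : (2 - m%:R) / 2 = - n%:R :> R by rewrite natrD natrM; field.
  by rewrite scalerA mulrN mulVf// scaleN1r.
- exact: Jstd_sqr.
- by apply: (open_near openT) => // y _; exact: lck_metric_sym.
- by apply: (open_near openT) => // y _; exact: lck_metric_J.
- exact: lck_metric_pos.
- by move=> a i j; exact: lck_metric_derivable.
- by move=> a b d; exact: lck_form_d2.
Qed.

Lemma lee_formE (c : chart R m M) x : U x -> lee_form J_field g_field c x = theta x.
Proof.
move=> Ux; rewrite /lee_form anti_lee_formE// mulmxN mulmxA.
by rewrite [_ *m Jstd n]Jstd_sqr mulNmx mul1mx opprK.
Qed.

Lemma punctured_hermitian : Defs.hermitian J_field g_field.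
Proof.
split=> c cM; last by move=> x _; exact: lck_metric_J.
by split=> [x _|X Y _ _ x _]; [exact: Jstd_sqr|exact: (nijenhuis_cst _ _ _ (@Jstd_sqr R n))].
Qed.

Lemma punctured_lck : lck J_field g_field.
Proof.
split; first exact: punctured_hermitian.
move=> c cM x; rewrite atlas_cod// => Ux; split=> [a b d|a b].
  by rewrite /wedge12 lee_formE//; exact: lck_form_d2.
rewrite -(theta_closed a b Ux) /d1; congr (_ - _); apply: near_eq_derive;
  by apply: (open_near (@punctured_open R n) Ux) => y Uy; rewrite lee_formE.
Qed.

Lemma punctured_integrable : integrable_lck J_field g_field.
Proof.
split; first exact: punctured_lck.
- move=> c cM x; rewrite atlas_cod// => Ux.
  have [E /orthonormal_basis_gram[gu _]] :=
    orthonormal_basis_exists (lck_metric_sym x) (lck_metric_pos Ux).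
  apply/eqP => /(congr1 trmx); rewrite /anti_lee_vector trmxK trmx0.
  move=> /(congr1 (mulmx (g_field c x))); rewrite mulKVmx// mulmx0 anti_lee_formE//.
  move=> /(congr1 (mulmx (Jstd n))); rewrite mulmxN mulmxA Jstd_sqr mulNmx mul1mx opprK mulmx0.
  by move/eqP; apply/negP; exact: theta_neq0.
- move=> c cM x; rewrite atlas_cod// => Ux.
  apply: (@circle_integral_manifold _ _ _ (re 0) (im 0)).
  + by rewrite addn2 addn1.
  + by rewrite re_im.
  + exact/punctured_modsq.
  move=> y yx; have Uy : U y by apply/punctured_modsq; rewrite /modsq yx; exact/punctured_modsq.
  split=> //; exists (- (2 / modsq y)).
    by rewrite oppr_eq0 mulf_neq0 ?invr_eq0 ?pnatr_eq0//; exact/punctured_modsq.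
  by rewrite anti_lee_formE// Jstd_theta scaleNr.
Qed.

Lemma punctured_not_gck : ~ globally_conformal_kahler J_field g_field.
Proof.
case=> f /(_ _ (erefl _))[].
rewrite atlas_cod// => sf df; apply: theta_not_exact sf _ => x Ux a.
by rewrite -df// lee_formE.
Qed.

End Example.

Theorem mainTheorem12 (R : realType) (n : nat) (n_ge1 : (1 <= n)%N) :
  exists (M : smooth_manifold R (2 * n + 2))
         (J : endomorphism_field M) (g : riemannian_metric M),
    integrable_lck J g /\ ~ globally_conformal_kahler J g.
Proof.
exists (punctured_space n), (J_field n), (g_field n); split.
  exact: punctured_integrable.
exact: punctured_not_gck.
Qed.
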